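(* For every $c\in\mathbb{R}$ with $|c|<1$, the dark solitary wave $\psi(t,x,y)=\Psi_c(x-ct)$, $$\Psi_c(z)=\sqrt{1-c^2}\,\tanh\big(z\sqrt{1-c^2}\big)+ic,\qquad z\in\mathbb{R},$$ of the Gross-Pitaevskii equation $$i\partial_t\psi+\tfrac12\Delta\psi+\psi(1-|\psi|^2)=0,\qquad (x,y)\in\mathbb{R}^2,$$ is transversally (linearly) unstable. That is, there exist $\sigma>0$, a real $k\neq0$ and a complex-valued function $w=w_1+iw_2$ with $w_1,w_2\in H^2(\mathbb{R};\mathbb{R})$, $w\neq 0$, such that $$i\sigma w-ic\,w'+\tfrac12\,(w''-k^2w)+(1-|\Psi_c|^2)\,w-2\,\mathrm{Re}\big(\overline{\Psi_c}\,w\big)\Psi_c=0\quad\text{on }\mathbb{R}.$$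
   Context: Linearizing the Gross-Pitaevskii equation about $\Psi_c$ in the moving frame $z=x-ct$ (writing $\psi=\Psi_c(z)+v(t,z,y)$) gives $$i(\partial_tv-c\,\partial_zv)+\tfrac12(\partial_{zz}+\partial_{yy})v+(1-|\Psi_c|^2)v-2\,\mathrm{Re}(\overline{\Psi_c}v)\Psi_c=0 .$$ Splitting into real and imaginary parts $(v_1,v_2)$ and looking for solutions of the form $(v_1,v_2)=e^{\sigma t}e^{iky}(w_1(z),w_2(z))$ gives, for $w=w_1+iw_2$ with $w_1,w_2$ real-valued, the equation in the claim. Transverse linear instability means the existence of a nontrivial solution of this eigenvalue problem with $\sigma>0$ and transverse frequency $k\neq 0$. *)

(* Defs.v *)
From HB Require Import structures.
From mathcomp Require Import all_boot all_order all_algebra.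
From mathcomp Require Import complex.
From mathcomp Require Import all_classical all_reals all_analysis.

Set Implicit Arguments.
Unset Strict Implicit.
Unset Printing Implicit Defensive.

Import Order.TTheory GRing.Theory Num.Theory.
Import numFieldNormedType.Exports.

Local Open Scope classical_set_scope.
Local Open Scope ring_scope.
Local Open Scope complex_scope.

Section Sobolev.
Context {R : realType}.
Implicit Types f g phi : R -> R.

Definition test_function phi : Prop :=
  (forall n x, derivable (derive1n n phi) x 1) /\
  compact (closure [set x | phi x != 0]).

(* [Rintegral] is total; the identity is only used for square-integrable [f]
   and [g], for which both integrands are integrable. *)
Definition weak_derivative (n : nat) f g : Prop :=
  forall phi, test_function phi ->
    Rintegral lebesgue_measure setT (fun x => f x * derive1n n phi x) =
    (-1) ^+ n * Rintegral lebesgue_measure setT (fun x => g x * phi x).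

Definition L2 f : Prop := f \in Lfun (@lebesgue_measure R) 2%:E.

(* [f] represents an element of the Sobolev space H^2(R; R) whose first and
   second weak derivatives are represented by [f1] and [f2]. *)
Definition H2 f f1 f2 : Prop :=
  [/\ L2 f, L2 f1, L2 f2, weak_derivative 1 f f1 & weak_derivative 2 f f2].

End Sobolev.

Section DarkSoliton.
Context {R : realType}.

Definition tanh (x : R) : R :=
  (expR x - expR (- x)) / (expR x + expR (- x)).

Definition Psi (c z : R) : R[i] :=
  (Num.sqrt (1 - c ^+ 2) * tanh (z * Num.sqrt (1 - c ^+ 2))) +i* c.

(* Gross-Pitaevskii linearized about [Psi c] in the frame z = x - c t, applied
   to the mode e^(sigma t) e^(i k y) w(z); [w], [dw], [ddw] are the values at
   [z] of the profile and of its first two derivatives. *)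
Definition linearized_GP_mode (c sigma k z : R) (w dw ddw : R[i]) : R[i] :=
  'i * sigma%:C * w - 'i * c%:C * dw + 2^-1 * (ddw - (k ^+ 2)%:C * w)
  + (1 - `|Psi c z| ^+ 2) * w
  - 2 * (complex.Re ((Psi c z)^* * w))%:C * Psi c z.

(* Elements of H^2 are classes of functions modulo equality a.e., so that both
   [w <> 0] and the equation are understood a.e. *)
Definition transversally_linearly_unstable (c : R) : Prop :=
  exists (sigma k : R) (w1 dw1 ddw1 w2 dw2 ddw2 : R -> R),
    [/\ 0 < sigma, k != 0, H2 w1 dw1 ddw1 & H2 w2 dw2 ddw2] /\
    ~ {ae lebesgue_measure, forall z, w1 z +i* w2 z = 0} /\
    {ae lebesgue_measure, forall z,
      linearized_GP_mode c sigma k z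
        (w1 z +i* w2 z) (dw1 z +i* dw2 z) (ddw1 z +i* ddw2 z) = 0}.

End DarkSoliton.

(* Main.v *)
(** After rescaling [x = a z] with [a = sqrt (1 - c^2)] and [g = c / a], the
stationary linearized operator [E] has an explicit zero mode [phi] of the form
[sech * polynomial in tanh] at the transverse frequency [k^2 / 2 = 1/2 - Y],
where [Y = 1 + g^2 - sqrt (1 + g^2 + g^4)].  All solutions of the homogeneous equation are
exponentials times polynomials in [tanh], so the reduced resolvent [K] at [phi]
is an explicit integral operator, with [E (K f) = f - kappa <phi, f> phi].  Let
[J (a, b) = (b, - a)] and [L u = <phi, u>].  For small [s > 0] the contraction
principle, in a space of exponentially decaying functions, solves
[u = phi + s K (L u * J u - L (J u) * u)]; the argument of [K] is annihilated by
[L], whence [E u = s (L u) J u - s (L (J u)) u], which is an unstable mode with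
growth rate [s L u > 0] and frequency shifted by [- s L (J u)]. *)
Require Import Defs.
From mathcomp Require Import all_boot all_order all_algebra.
From mathcomp Require Import complex ring lra.
From mathcomp Require Import all_classical all_reals all_analysis.
From mathcomp Require Import measurable_realfun.
Import Order.TTheory GRing.Theory Num.Theory.
Import numFieldNormedType.Exports.
Local Open Scope classical_set_scope.
Local Open Scope ring_scope.

Set Implicit Arguments.
Unset Strict Implicit.
Unset Printing Implicit Defensive.

(** * Derivatives *)

Section Calculus.
Context {R : realType}.
Implicit Types (f g : R -> R) (a b x : R).

(** An unstable mode solves [E u = sigma J u + eta u], with two unknown numbers besides [u]. As [E]
    is symmetric with [phi] in its kernel, the right-hand side has to be orthogonal to [phi]. Taking
    [(sigma, eta)] proportional to [(L u, - L (J u))] meets this condition identically in [u], so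
    the scalar solvability condition and the equation for the remainder merge into a single
    fixed-point problem, and no implicit function theorem is involved. Growth is positive for small
    [s] because [L phi] is the squared norm of [phi], whereas [L (J phi) = 0] by antisymmetry of
    [J], so the frequency hardly moves. No Fredholm theory enters either: the homogeneous solutions
    being elementary, the equation satisfied by [K f] is an algebraic identity in [tanh x] and a few
    half-line integrals, modulo the relations between [g], [Y] and [l]. The weight [exp (- |x| / 2)]
    leaves room for the factor [x exp (- |x|)] that the finite part of the Green function
    contains. *)

Definition has_deriv f x a : Prop := is_derive x 1 f a.

Lemma has_deriv_continuous f x a : has_deriv f x a -> {for x, continuous f}.
Proof. by move=> [/derivable1_diffP/differentiable_continuous]. Qed.

Lemma has_deriv_eq f x a b : has_deriv f x a -> a = b -> has_deriv f x b.
Proof. by move=> + <-. Qed.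

Lemma has_deriv_derivable f x a : has_deriv f x a -> derivable f x 1.
Proof. by case. Qed.

Lemma has_deriv_derive1 f x a : has_deriv f x a -> derive1 f x = a.
Proof. by rewrite derive1E; case. Qed.

Lemma has_deriv_cst b x : has_deriv (fun=> b) x 0.
Proof. exact: is_derive_cst. Qed.

Lemma has_deriv_id x : has_deriv (fun y => y) x 1.
Proof. exact: is_derive_id. Qed.

Lemma has_derivD f g x a b : has_deriv f x a -> has_deriv g x b ->
  has_deriv (fun y => f y + g y) x (a + b).
Proof. exact: is_deriveD. Qed.

Lemma has_derivN f x a : has_deriv f x a -> has_deriv (fun y => - f y) x (- a).
Proof. exact: is_deriveN. Qed.

Lemma has_derivM f g x a b : has_deriv f x a -> has_deriv g x b ->
  has_deriv (fun y => f y * g y) x (a * g x + f x * b).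
Proof.
move=> fa gb; apply: has_deriv_eq; first exact: (is_deriveM fa gb).
by rewrite addrC /GRing.scale /= (mulrC a).
Qed.

Lemma has_deriv_comp f g x a b : has_deriv g x b -> has_deriv f (g x) a ->
  has_deriv (fun y => f (g y)) x (a * b).
Proof. by move=> gb fa; exact: (is_derive1_comp fa gb). Qed.

Lemma has_deriv_expR f x a : has_deriv f x a ->
  has_deriv (fun y => expR (f y)) x (expR (f x) * a).
Proof. by move=> fa; apply: has_deriv_comp fa _; exact: is_derive_expR. Qed.

End Calculus.

Ltac derive_auto := lazymatch goal with
  | |- has_deriv (fun y => @?a y + @?b y) _ _ =>
    apply: (@has_derivD _ a b); derive_auto
  | |- has_deriv (fun y => @?a y * @?b y) _ _ =>
    apply: (@has_derivM _ a b); derive_auto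
  | |- has_deriv (fun y => - @?a y) _ _ =>
    apply: (@has_derivN _ a); derive_auto
  | |- has_deriv (fun y => expR (@?a y)) _ _ =>
    apply: (@has_deriv_expR _ a); derive_auto
  | |- has_deriv (fun y => y) _ _ => exact: has_deriv_id
  | H : has_deriv ?f ?x _ |- has_deriv (fun y => ?f y) ?x _ => exact: H
  | H : has_deriv ?f ?x _ |- has_deriv ?f ?x _ => exact: H
  | |- _ => exact: has_deriv_cst
  end.
Ltac derive_eq := apply: has_deriv_eq; [derive_auto | cbv beta].

(** * Exponentially decaying functions and half-line convolutions *)

Section Decay.
Context {R : realType}.
Implicit Types (f g : R -> R) (l x M : R).
Local Notation mu := (@lebesgue_measure R).

(** The rate [1/2] lies strictly below every decay rate [l >= 1] of the homogeneous solutions, so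
    convolution with [exp (- l |x|)] preserves this weight, even when iterated. *)
Definition ewt x : R := expR (- (`|x| / 2)).

Definition decay M f : Prop :=
  continuous f /\ forall x, `|f x| <= M * ewt x.

(** The bounded solution of [u' = f - l u]; its mirror image [future] solves [u' = l u - f], and
    inherits its estimates by reflection. *)
Definition past l f x : R :=
  expR (- (l * x)) * Rintegral mu `]-oo, x] (fun s => expR (l * s) * f s).

Definition future l f x : R := past l (fun s => f (- s)) (- x).

Lemma ewt_gt0 x : 0 < ewt x.
Proof. exact: expR_gt0. Qed.

Lemma ewt_le1 x : ewt x <= 1.
Proof. by rewrite /ewt -expR0 ler_expR oppr_le0 divr_ge0. Qed.

Lemma ewtN x : ewt (- x) = ewt x.
Proof. by rewrite /ewt normrN. Qed.

Lemma ewt_shift s x : s <= x -> ewt s <= expR ((x - s) / 2) * ewt x.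
Proof.
move=> sx; rewrite /ewt -expRD ler_expR.
have := ler_normD s (x - s); rewrite subrKC (@ger0_norm _ (x - s)) ?subr_ge0//.
lra.
Qed.

Lemma decay_ge0 M f : decay M f -> 0 <= M.
Proof.
move=> [_ /(_ 0) h]; have := le_trans (normr_ge0 _) h.
by rewrite pmulr_lge0// ewt_gt0.
Qed.

Lemma decay_opp M f : decay M f -> decay M (fun s => f (- s)).
Proof.
move=> [cf fM]; split; last by move=> x; rewrite -(ewtN x).
by move=> x; apply: continuous_comp; [exact: oppr_continuous | exact: cf].
Qed.

Lemma continuous_expRM l : continuous (fun s : R => expR (l * s)).
Proof.
by move=> s; apply: has_deriv_continuous; derive_auto.
Qed.

Lemma integral_expR_future l x : 0 < l ->
  (\int[mu]_(s in `[x, +oo[) (expR (- (l * s)))%:E =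
   (expR (- (l * x)) / l)%:E)%E.
Proof.
move=> l0.
have dF y : has_deriv (fun s => - expR (- (l * s)) / l) y (expR (- (l * y))).
  by derive_eq; field; rewrite gt_eqF.
rewrite (@ge0_continuous_FTC2y _ _ (fun s => - expR (- (l * s)) / l) _ 0).
- by rewrite -EFinB sub0r mulNr opprK.
- by move=> y _; exact: expR_ge0.
- apply: continuous_subspaceT => y.
  by apply: (@has_deriv_continuous _ (fun s => expR (- (l * s)))); derive_auto.
- rewrite (_ : 0 = - 0 / l); last by rewrite oppr0 mul0r.
  apply: cvgMl; apply: cvgN.
  apply: (@cvg_comp _ _ _ ( *%R l) (fun s => expR (- s))); last exact: cvgr_expR.
  by apply: gt0_cvgMry => //; exact: cvg_id.
- by move=> y _; exact: has_deriv_derivable (dF y).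
- by apply: cvg_at_right_filter; have := has_deriv_continuous (dF x).
- by move=> y _; rewrite (has_deriv_derive1 (dF y)).
Qed.

Lemma integral_expR_past l x : 0 < l ->
  (\int[mu]_(s in `]-oo, x]) (expR (l * s))%:E = (expR (l * x) / l)%:E)%E.
Proof.
move=> l0; rewrite -[x in `]-oo, x]]opprK ge0_integration_by_substitutionNy.
- under eq_integral => s _ do rewrite /= mulrN.
  by rewrite integral_expR_future// mulrN opprK.
- by apply: continuous_subspaceT; exact: continuous_expRM.
- by move=> y _; exact: expR_ge0.
Qed.

Lemma integrable_expR_past l x : 0 < l ->
  mu.-integrable `]-oo, x] (EFin \o (fun s => expR (l * s))).
Proof.
move=> l0; apply/integrableP; split.
  apply/measurable_EFinP; apply: measurable_funTS.
  apply: continuous_measurable_fun; exact: continuous_expRM.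
under eq_integral => s _ do rewrite /= ger0_norm ?expR_ge0//.
by rewrite integral_expR_past// ltry.
Qed.

Lemma integrable_scale d (T : measurableType d) (m : {measure set T -> \bar R})
    (D : set T) (h : T -> R) (a : R) : measurable D ->
  m.-integrable D (EFin \o h) -> m.-integrable D (EFin \o (fun s => a * h s)).
Proof. by move=> mD hi; have := integrableZl mD a hi. Qed.

(** Moving the weight from [s] to [x] costs [expR ((x - s) / 2)], which leaves the exponent
    [l - 1/2 > 0], integrable at [-oo]. *)
Lemma past_integrand_bound l f M s x : 1 <= l -> decay M f -> s <= x ->
  `|expR (l * s) * f s| <= M * ewt x * expR (x / 2) * expR ((l - 1 / 2) * s).
Proof.
move=> l1 df sx; have M0 := decay_ge0 df.
rewrite normrM ger0_norm ?expR_ge0//.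
apply: (@le_trans _ _ (expR (l * s) * (M * (expR ((x - s) / 2) * ewt x)))).
  rewrite ler_wpM2l ?expR_ge0//; apply: le_trans (df.2 s) _.
  by rewrite ler_wpM2l// ewt_shift.
rewrite le_eqVlt; apply/orP; left; apply/eqP.
rewrite [expR ((x - s) / 2)](_ : _ = expR (x / 2) * expR (- (s / 2))); last first.
  by rewrite -expRD; congr expR; lra.
rewrite [expR ((l - _) * s)](_ : _ = expR (l * s) * expR (- (s / 2))); last first.
  by rewrite -expRD; congr expR; lra.
ring.
Qed.

Lemma past_integrable l f M x : 1 <= l -> decay M f ->
  mu.-integrable `]-oo, x] (EFin \o (fun s => expR (l * s) * f s)).
Proof.
move=> l1 df.
have cf : continuous (fun s => expR (l * s) * f s).
  by move=> s; apply: cvgM; [exact: continuous_expRM | exact: df.1].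
apply: (@le_integrable _ _ _ mu _ (measurable_itv _) _
    (EFin \o (fun s => M * ewt x * expR (x / 2) * expR ((l - 1 / 2) * s)))) => //.
- apply/measurable_EFinP; apply: measurable_funTS.
  exact: continuous_measurable_fun.
- move=> s /=; rewrite in_itv/= => sx; rewrite lee_fin.
  apply: le_trans (past_integrand_bound l1 df sx) _; exact: ler_norm.
- have l0 : 0 < l - 1 / 2 by lra.
  by apply: integrable_scale => //; exact: integrable_expR_past.
Qed.

(** Integration gives the factor [1 / (l - 1/2)], which is at most [2] for [l >= 1]. *)
Lemma past_bound l f M x : 1 <= l -> decay M f ->
  `|past l f x| <= 2 * M * ewt x.
Proof.
move=> l1 df; have M0 := decay_ge0 df.
have l0 : 0 < l - 1 / 2 by lra.
have int1 := past_integrable x l1 df.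
set C := M * ewt x * expR (x / 2).
have int2 : mu.-integrable `]-oo, x]
    (EFin \o (fun s => C * expR ((l - 1 / 2) * s))).
  by apply: integrable_scale => //; exact: integrable_expR_past.
rewrite /past normrM ger0_norm ?expR_ge0//.
apply: (@le_trans _ _ (expR (- (l * x)) * (C * (expR ((l - 1 / 2) * x) / (l - 1 / 2))))).
  rewrite ler_wpM2l ?expR_ge0//.
  apply: le_trans (le_normr_Rintegral _ int1) _ => //.
  apply: (@le_trans _ _ (Rintegral mu `]-oo, x] (fun s => C * expR ((l - 1 / 2) * s)))).
    apply: le_Rintegral => //.
      exact: (integrable_norm int1).
    by move=> s /=; rewrite in_itv/= => sx; exact: past_integrand_bound df sx.
  rewrite RintegralZl//; last exact: integrable_expR_past.
  by rewrite /Rintegral integral_expR_past.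
rewrite [X in X <= _](_ : _ = M * ewt x / (l - 1 / 2)); last first.
  rewrite [expR ((l - _) * x)](_ : _ = expR (l * x) * expR (- (x / 2))); last first.
    by rewrite -expRD; congr expR; lra.
  rewrite /C !expRN; field.
  by rewrite !gt_eqF ?expR_gt0//; lra.
have W := mulr_ge0 M0 (ltW (ewt_gt0 x)).
rewrite ler_pdivrMr// -(mulrA 2) mulrAC ler_peMl//; lra.
Qed.

Lemma has_deriv_past l f M x : 1 <= l -> decay M f ->
  has_deriv (past l f) x (f x - l * past l f x).
Proof.
move=> l1 df.
(* Any right end beyond [x] would do: it makes [x] interior for the fundamental theorem of
   calculus. *)
have xx1 : x < x + 1 by rewrite ltrDl.
have cf : {for x, continuous (fun s => expR (l * s) * f s)}.
  by apply: cvgM; [exact: continuous_expRM | exact: df.1].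
have [|dI I'] := continuous_FTC1 xx1 (past_integrable (x + 1) l1 df) _ cf.
  by rewrite ltNyr.
have dF : has_deriv
    (fun y => Rintegral mu `]-oo, y] (fun s => expR (l * s) * f s)) x
    (expR (l * x) * f x).
  by split; [exact: dI | rewrite -derive1E; exact: I'].
rewrite /past; derive_eq; rewrite !expRN; field.
by rewrite gt_eqF ?expR_gt0.
Qed.

Lemma past_linear l f g M N a b x : 1 <= l -> decay M f -> decay N g ->
  past l (fun s => a * f s + b * g s) x = a * past l f x + b * past l g x.
Proof.
move=> l1 df dg; rewrite /past.
have intf := past_integrable x l1 df; have intg := past_integrable x l1 dg.
rewrite [X in _ * X = _](_ : _ =
  Rintegral mu `]-oo, x] (fun s => a * (expR (l * s) * f s) + b * (expR (l * s) * g s))).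
  rewrite RintegralD//; last 2 first.
    exact: integrable_scale.
    exact: integrable_scale.
  by rewrite !RintegralZl//; ring.
by apply: eq_Rintegral => s _; ring.
Qed.

Lemma past_ge0 l f x : (forall s, 0 <= f s) -> 0 <= past l f x.
Proof.
move=> f0; rewrite mulr_ge0 ?expR_ge0//; apply: Rintegral_ge0 => s _.
by rewrite mulr_ge0 ?expR_ge0.
Qed.

(** A zero of the nonnegative function [past l f] would be a minimum, where the equation
    [u' = f - l u] gives the derivative [f x > 0]. *)
Lemma past_gt0 l f M x : 1 <= l -> decay M f -> (forall s, 0 <= f s) ->
  0 < f x -> 0 < past l f x.
Proof.
move=> l1 df f0 fx; rewrite lt_neqAle past_ge0// andbT; apply/negP => /eqP p0.
have d y := has_deriv_past y l1 df.
have x1 : x - 1 <= x + 1 by lra.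
have := derive1_at_min x1 (fun y _ => has_deriv_derivable (d y)).
move=> /(_ x); rewrite in_itv/= ltrDl gtrBl ltr01/= => /(_ erefl) min.
have {min} : is_derive x 1 (past l f) 0.
  by apply: min => y _; rewrite -p0 past_ge0.
move=> /has_deriv_derive1; rewrite (has_deriv_derive1 (d x)) -p0 mulr0 subr0.
by move=> f0x; rewrite f0x ltxx in fx.
Qed.

Lemma future_bound l f M x : 1 <= l -> decay M f ->
  `|future l f x| <= 2 * M * ewt x.
Proof. by move=> l1 df; rewrite -(ewtN x); exact/past_bound/decay_opp. Qed.

Lemma has_deriv_future l f M x : 1 <= l -> decay M f ->
  has_deriv (future l f) x (l * future l f x - f x).
Proof.
move=> l1 df; rewrite /future.
have := has_deriv_past (- x) l1 (decay_opp df).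
move=> /(has_deriv_comp (has_derivN (has_deriv_id x))) d.
apply: has_deriv_eq; first exact: d.
by rewrite opprK mulrN1 opprB.
Qed.

Lemma future_linear l f g M N a b x : 1 <= l -> decay M f -> decay N g ->
  future l (fun s => a * f s + b * g s) x = a * future l f x + b * future l g x.
Proof.
by move=> l1 /decay_opp df /decay_opp dg; exact: (past_linear _ _ _ l1 df dg).
Qed.

Lemma future_gt0 l f M x : 1 <= l -> decay M f -> (forall s, 0 <= f s) ->
  0 < f x -> 0 < future l f x.
Proof.
move=> l1 df f0 fx; apply: (past_gt0 l1 (decay_opp df)) => //.
by rewrite opprK.
Qed.

Lemma decay_past l f M : 1 <= l -> decay M f -> decay (2 * M) (past l f).
Proof.
move=> l1 df; split; last by move=> x; exact: past_bound.
by move=> x; exact: (has_deriv_continuous (has_deriv_past x l1 df)).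
Qed.

Lemma decay_future l f M : 1 <= l -> decay M f -> decay (2 * M) (future l f).
Proof.
move=> l1 df; split; last by move=> x; exact: future_bound.
by move=> x; exact: (has_deriv_continuous (has_deriv_future x l1 df)).
Qed.

Lemma decayM_bounded f g M N : continuous g -> (forall x, `|g x| <= N) ->
  decay M f -> decay (N * M) (fun x => g x * f x).
Proof.
move=> cg gN [cf fM]; split; first by move=> x; apply: cvgM; [exact: cg|exact: cf].
by move=> x; rewrite normrM -mulrA; apply: ler_pM.
Qed.

Lemma decayD f g M N : decay M f -> decay N g ->
  decay (M + N) (fun x => f x + g x).
Proof.
move=> [cf fM] [cg gN]; split; first by move=> x; apply: cvgD; [exact: cf|exact: cg].
by move=> x; rewrite mulrDl; apply: le_trans (ler_normD _ _) _; exact: lerD.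
Qed.

Lemma decayZ f M a : decay M f -> decay (`|a| * M) (fun x => a * f x).
Proof. by apply: decayM_bounded => // x; exact: cvg_cst. Qed.

Lemma decay_le M N f : M <= N -> decay M f -> decay N f.
Proof.
move=> MN [cf fM]; split=> // x; apply: le_trans (fM x) _.
by rewrite ler_wpM2r// ltW// ewt_gt0.
Qed.

End Decay.

(** * Hyperbolic tangent and secant *)

Section Tanh.
Context {R : realType}.
Implicit Types (x : R).

Definition sech x : R := 2 / (expR x + expR (- x)).

Lemma cosh2_gt0 x : 0 < expR x + expR (- x).
Proof. by rewrite addr_gt0 ?expR_gt0. Qed.

Lemma sqr_sech x : sech x ^+ 2 = 1 - tanh x ^+ 2.
Proof.
rewrite /sech /tanh expRN; field.
by rewrite !gt_eqF ?expR_gt0// addr_gt0 ?ltr01// mulr_gt0 ?expR_gt0.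
Qed.

Lemma sechE x : sech x = expR x * (1 - tanh x).
Proof.
rewrite /sech /tanh expRN; field.
by rewrite !gt_eqF ?expR_gt0// addr_gt0 ?ltr01// mulr_gt0 ?expR_gt0.
Qed.

Lemma sechEN x : sech x = expR (- x) * (1 + tanh x).
Proof.
rewrite /sech /tanh expRN; field.
by rewrite !gt_eqF ?expR_gt0// addr_gt0 ?ltr01// mulr_gt0 ?expR_gt0.
Qed.

Lemma has_deriv_tanh x : has_deriv tanh x (1 - tanh x ^+ 2).
Proof.
have q0 : expR x + expR (- x) != 0 by rewrite gt_eqF// cosh2_gt0.
have dq : has_deriv (fun y => expR y + expR (- y)) x (expR x - expR (- x)).
  by derive_eq; ring.
have dV : has_deriv (fun y => (expR y + expR (- y))^-1) x
    (- (expR x - expR (- x)) / (expR x + expR (- x)) ^+ 2).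
  apply: has_deriv_eq; first exact: (@is_deriveV R _ x _ 1 q0 dq).
  by rewrite /GRing.scale /=; field.
rewrite /tanh; derive_eq.
by field.
Qed.

Lemma has_deriv_sech x : has_deriv sech x (- (sech x * tanh x)).
Proof.
rewrite (_ : sech = fun x => expR x * (1 - tanh x)); last first.
  by apply/funext => y; exact: sechE.
have dt := has_deriv_tanh x.
by derive_eq; ring.
Qed.

Lemma sech_gt0 x : 0 < sech x.
Proof. by rewrite divr_gt0// cosh2_gt0. Qed.

Lemma tanh_bound x : `|tanh x| <= 1.
Proof.
rewrite -[leRHS]normr1 -ler_sqr ?nnegrE// !real_normK ?num_real// expr1n.
by have := sqr_ge0 (sech x); rewrite sqr_sech subr_ge0.
Qed.

Lemma continuous_tanh : continuous (@tanh R).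
Proof. by move=> x; exact: has_deriv_continuous (has_deriv_tanh x). Qed.

Lemma sech_le x : sech x <= 2 * ewt x.
Proof.
rewrite /sech ler_wpM2l// /ewt [expR (- (_ / _))]expRN lef_pV2 ?posrE ?cosh2_gt0 ?expR_gt0//.
have [x0|x0] := leP 0 x.
- rewrite ger0_norm//; apply: (@le_trans _ _ (expR x)).
    by rewrite ler_expR; lra.
  by rewrite lerDl expR_ge0.
- rewrite ltr0_norm//; apply: (@le_trans _ _ (expR (- x))).
    by rewrite ler_expR; lra.
  by rewrite lerDr expR_ge0.
Qed.

Lemma decay_sech : decay 2 sech.
Proof.
split=> x; first exact: has_deriv_continuous (has_deriv_sech x).
by rewrite ger0_norm ?sech_le// ltW// sech_gt0.
Qed.

End Tanh.

(** * The reduced resolvent *)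

Section Operators.
Context {R : realType}.
Implicit Types (f g h : R -> R) (x M N : R).

Definition multiplier h : Prop :=
  continuous h /\ exists N, forall x, `|h x| <= N.

Lemma multiplier_cst (a : R) : multiplier (fun=> a).
Proof. by split; [move=> x; exact: cvg_cst | exists `|a|]. Qed.

Lemma multiplier_tanh : multiplier tanh.
Proof. by split; [exact: continuous_tanh | exists 1; exact: tanh_bound]. Qed.

Lemma multiplierN h : multiplier h -> multiplier (fun x => - h x).
Proof.
move=> [ch [N hN]]; split; first by move=> x; apply: cvgN; exact: ch.
by exists N => x; rewrite normrN.
Qed.

Lemma multiplierD h k : multiplier h -> multiplier k ->
  multiplier (fun x => h x + k x).
Proof.
move=> [ch [N hN]] [ck [P kP]]; split.
  by move=> x; apply: cvgD; [exact: ch | exact: ck].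
by exists (N + P) => x; apply: le_trans (ler_normD _ _) _; exact: lerD.
Qed.

Lemma multiplierM h k : multiplier h -> multiplier k ->
  multiplier (fun x => h x * k x).
Proof.
move=> [ch [N hN]] [ck [P kP]]; split.
  by move=> x; apply: cvgM; [exact: ch | exact: ck].
by exists (N * P) => x; rewrite normrM; exact: ler_pM.
Qed.

(** Linearity is asked only on decaying arguments: the total integral is linear only where the
    integrands are integrable. *)
Definition bounded_op (K : (R -> R) -> (R -> R) -> R -> R) : Prop :=
  (exists C, forall f1 f2 M, decay M f1 -> decay M f2 ->
     decay (C * M) (K f1 f2)) /\
  (forall f1 f2 g1 g2 M N a b x, decay M f1 -> decay M f2 ->
     decay N g1 -> decay N g2 ->
     K (fun s => a * f1 s + b * g1 s) (fun s => a * f2 s + b * g2 s) x =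
     a * K f1 f2 x + b * K g1 g2 x).

Lemma bounded_op_fst : bounded_op (fun f1 _ => f1).
Proof. by split=> //; exists 1 => f1 f2 M; rewrite mul1r. Qed.

Lemma bounded_op_snd : bounded_op (fun _ f2 => f2).
Proof. by split=> //; exists 1 => f1 f2 M; rewrite mul1r. Qed.

Lemma bounded_opM h K : multiplier h -> bounded_op K ->
  bounded_op (fun f1 f2 x => h x * K f1 f2 x).
Proof.
move=> [ch [N hN]] [[C KC] KL]; split.
  exists (N * C) => f1 f2 M d1 d2; rewrite -mulrA.
  exact/decayM_bounded/KC.
move=> f1 f2 g1 g2 M P a b x d1 d2 e1 e2.
by rewrite (KL _ _ _ _ _ _ _ _ _ d1 d2 e1 e2); ring.
Qed.

Lemma bounded_opD K L : bounded_op K -> bounded_op L ->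
  bounded_op (fun f1 f2 x => K f1 f2 x + L f1 f2 x).
Proof.
move=> [[C KC] KL] [[D LD] LL]; split.
  by exists (C + D) => f1 f2 M d1 d2; rewrite mulrDl; apply: decayD; auto.
move=> f1 f2 g1 g2 M P a b x d1 d2 e1 e2.
rewrite (KL _ _ _ _ _ _ _ _ _ d1 d2 e1 e2) (LL _ _ _ _ _ _ _ _ _ d1 d2 e1 e2).
ring.
Qed.

Lemma bounded_opN K : bounded_op K -> bounded_op (fun f1 f2 x => - K f1 f2 x).
Proof.
move=> bK; have := bounded_opM (multiplier_cst (-1)) bK.
by under eq_fun do under eq_fun do under eq_fun do rewrite mulN1r.
Qed.

Lemma bounded_op_past l K : 1 <= l -> bounded_op K ->
  bounded_op (fun f1 f2 => past l (K f1 f2)).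
Proof.
move=> l1 [[C KC] KL]; split.
  by exists (2 * C) => f1 f2 M d1 d2; rewrite -mulrA; apply: decay_past; auto.
move=> f1 f2 g1 g2 M P a b x d1 d2 e1 e2.
rewrite -(past_linear _ _ _ l1 (KC _ _ _ d1 d2) (KC _ _ _ e1 e2)).
by congr past; apply/funext => s; exact: (KL _ _ _ _ _ _ _ _ _ d1 d2 e1 e2).
Qed.

Lemma bounded_op_future l K : 1 <= l -> bounded_op K ->
  bounded_op (fun f1 f2 => future l (K f1 f2)).
Proof.
move=> l1 [[C KC] KL]; split.
  by exists (2 * C) => f1 f2 M d1 d2; rewrite -mulrA; apply: decay_future; auto.
move=> f1 f2 g1 g2 M P a b x d1 d2 e1 e2.
rewrite -(future_linear _ _ _ l1 (KC _ _ _ d1 d2) (KC _ _ _ e1 e2)).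
by congr future; apply/funext => s; exact: (KL _ _ _ _ _ _ _ _ _ d1 d2 e1 e2).
Qed.

End Operators.

Ltac multiplier_auto := lazymatch goal with
  | |- multiplier (fun x => @?a x + @?b x) =>
    apply: (@multiplierD _ a b); multiplier_auto
  | |- multiplier (fun x => @?a x * @?b x) =>
    apply: (@multiplierM _ a b); multiplier_auto
  | |- multiplier (fun x => - @?a x) =>
    apply: (@multiplierN _ a); multiplier_auto
  | |- multiplier (fun x => tanh x) => exact: multiplier_tanh
  | |- _ => exact: multiplier_cst
  end.
Ltac bounded_op_auto := lazymatch goal with
  | |- bounded_op (fun f1 f2 x => @?a f1 f2 x + @?b f1 f2 x) =>
    apply: (@bounded_opD _ a b); bounded_op_auto
  | |- bounded_op (fun f1 f2 x => - @?a f1 f2 x) =>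
    apply: (@bounded_opN _ a); bounded_op_auto
  | |- bounded_op (fun f1 f2 x => @?h x * @?a f1 f2 x) =>
    apply: (@bounded_opM _ h a); [multiplier_auto | bounded_op_auto]
  | |- bounded_op (fun f1 f2 => past _ _) =>
    apply: bounded_op_past => //; bounded_op_auto
  | |- bounded_op (fun f1 f2 => future _ _) =>
    apply: bounded_op_future => //; bounded_op_auto
  | H : bounded_op ?K |- bounded_op (fun f1 f2 x => ?K f1 f2 x) => exact: H
  | |- _ => first [exact: bounded_op_fst | exact: bounded_op_snd]
  end.

(** * The Green function at the critical frequency *)

Section Resolvent.
Context {R : realType}.
Variables (g Y l : R).
Implicit Types (f : R -> R) (t x M : R).

(* The homogeneous equation at frequency [mu] is solved by
   [e^(- r x) (3 g (t^2 + r t + (r^2 - 1) / 3), (Z - 2) (t + r))], [t = tanh x],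
   where [mu = r^2 / 2 - Z] and [Z^2 - 2 (1 + g^2) Z + g^2 r^2 = 0].  At
   [mu = 1/2 - Y] the decay rates are [r = 1], with [Z = Y], giving [slow], and
   [r = l], with [Z = 2 - Y], giving [fast] after normalization; [dslow] is the
   derivative of the first family in [r].  The reflection
   [(w1, w2)(x) -> (- w1, w2)(- x)] preserves the equation. *)
Definition slow1 t : R := 3 * g * (t * t + t).
Definition slow2 t : R := - (2 - Y) * (1 + t).
Definition dslow1 t : R := 3 * g * (t + 2 / 3).
Definition dslow2 t : R :=
  - (2 - Y) + Y * (2 - Y) / (1 - Y + Y * Y) * (1 + t).
(** The normalizing factor is [(2 - Y) / g]. Since [g^2 (1 - 2 Y) = Y (2 - Y)], it turns the second
    component [- Y (t + l)] into [fast2], and the pair stays nonzero at [g = 0], where [Y = 0]. *)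
Definition fast1 t : R := 3 * (2 - Y) * (t * t + l * t + 4 * (1 - Y) / 3).
Definition fast2 t : R := - g * (1 - 2 * Y) * (t + l).

(* Coefficients of the derivatives of [e^(- r x) h (tanh x)]; [dslow_x] also
   receives [- slow] from the [r]-derivative of the exponential. *)
Definition slow1_x t : R := 3 * g * (2 * t + 1) * (1 - t * t) - slow1 t.
Definition slow2_x t : R := - (2 - Y) * (1 - t * t) - slow2 t.
Definition dslow1_x t : R := 3 * g * (1 - t * t) - dslow1 t - slow1 t.
Definition dslow2_x t : R :=
  Y * (2 - Y) / (1 - Y + Y * Y) * (1 - t * t) - dslow2 t - slow2 t.
Definition fast1_x t : R :=
  3 * (2 - Y) * (2 * t + l) * (1 - t * t) - l * fast1 t.
Definition fast2_x t : R := - g * (1 - 2 * Y) * (1 - t * t) - l * fast2 t.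

(* Inverses of the Wronskians of the growing and decaying solutions, for the slow
   family the residue at [r = 1]. *)
Definition kappa1 : R := - (4 * (1 - Y) * (2 - Y))^-1.
Definition kappa2 : R := (8 * l * (1 - Y) ^+ 2 * (2 - Y) * (1 - 2 * Y))^-1.

Section Applied.
Variables (f1 f2 : R -> R).

(** [E] being symmetric, the Green function for [s < x] is the solution decaying at [+oo], taken at
    [x], times the one decaying at [-oo], taken at [s]. The latter is the reflected solution, whence
    the signs and the arguments [- tanh s]. *)
Definition past_slow : R -> R :=
  past 1 (fun s => - slow1 (- tanh s) * f1 s + slow2 (- tanh s) * f2 s).
Definition past_dslow : R -> R :=
  past 1 (fun s => - dslow1 (- tanh s) * f1 s + dslow2 (- tanh s) * f2 s).
(** The convolution square of [exp (- x)] on [x > 0] is [x exp (- x)]: this is the term that arises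
    when [exp (- r (x - s))] is differentiated in [r] at [r = 1]. *)
Definition past2_slow : R -> R := past 1 past_slow.
Definition past_fast : R -> R :=
  past l (fun s => - fast1 (- tanh s) * f1 s + fast2 (- tanh s) * f2 s).
Definition future_slow : R -> R :=
  future 1 (fun s => slow1 (tanh s) * f1 s + slow2 (tanh s) * f2 s).
Definition future_dslow : R -> R :=
  future 1 (fun s => dslow1 (tanh s) * f1 s + dslow2 (tanh s) * f2 s).
Definition future2_slow : R -> R := future 1 future_slow.
Definition future_fast : R -> R :=
  future l (fun s => fast1 (tanh s) * f1 s + fast2 (tanh s) * f2 s).

(* The Green function at frequency [mu] has a simple pole at [mu = 1/2 - Y]; this is its
   finite part, up to a multiple of the projection onto the zero mode. *)
Definition resolvent1 x : R :=
  kappa1 * (dslow1 (tanh x) * past_slow x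
            + slow1 (tanh x) * (past_dslow x - past2_slow x)
            - dslow1 (- tanh x) * future_slow x
            - slow1 (- tanh x) * (future_dslow x - future2_slow x))
  + kappa2 * (fast1 (tanh x) * past_fast x - fast1 (- tanh x) * future_fast x).
Definition resolvent2 x : R :=
  kappa1 * (dslow2 (tanh x) * past_slow x
            + slow2 (tanh x) * (past_dslow x - past2_slow x)
            + dslow2 (- tanh x) * future_slow x
            + slow2 (- tanh x) * (future_dslow x - future2_slow x))
  + kappa2 * (fast2 (tanh x) * past_fast x + fast2 (- tanh x) * future_fast x).
Definition resolvent1_x x : R :=
  kappa1 * (dslow1_x (tanh x) * past_slow x
            + slow1_x (tanh x) * (past_dslow x - past2_slow x)
            + dslow1_x (- tanh x) * future_slow x
            + slow1_x (- tanh x) * (future_dslow x - future2_slow x))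
  + kappa2 * (fast1_x (tanh x) * past_fast x + fast1_x (- tanh x) * future_fast x).
Definition resolvent2_x x : R :=
  kappa1 * (dslow2_x (tanh x) * past_slow x
            + slow2_x (tanh x) * (past_dslow x - past2_slow x)
            - dslow2_x (- tanh x) * future_slow x
            - slow2_x (- tanh x) * (future_dslow x - future2_slow x))
  + kappa2 * (fast2_x (tanh x) * past_fast x - fast2_x (- tanh x) * future_fast x).

(** The quotient [Y (2 - Y) / (1 - Y + Y^2)] is [dZ/dr] at [r = 1], so the numerator is [dmu/dr] and
    [kappa0 = - kappa1 * dmu/dr]. Differentiating the homogeneous equation in [r] gives
    [E (dslow) = dmu/dr * slow], with the exponentials included, and this produces the second term
    of the residue. *)
Definition kappa0 : R :=
  (1 - Y * (2 - Y) / (1 - Y + Y * Y)) / (4 * (1 - Y) * (2 - Y)).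
Definition residue1 x : R :=
  f1 x - kappa0 * (slow1 (tanh x) * past_slow x - slow1 (- tanh x) * future_slow x).
Definition residue2 x : R :=
  f2 x - kappa0 * (slow2 (tanh x) * past_slow x + slow2 (- tanh x) * future_slow x).

End Applied.

Hypotheses (Y0 : 0 <= Y) (Yh : Y < 1 / 2).
(* The dispersion relation, oriented as a rewrite rule for [field]. *)
Hypothesis gY : Y * Y = 2 * Y - g * g + 2 * g * g * Y.
Hypothesis l1 : 1 <= l.
Hypothesis ll : l * l = 5 - 4 * Y.

Lemma bounded_op_past_slow : bounded_op past_slow.
Proof. by rewrite /past_slow /slow1 /slow2; bounded_op_auto. Qed.
Lemma bounded_op_past_dslow : bounded_op past_dslow.
Proof. by rewrite /past_dslow /dslow1 /dslow2; bounded_op_auto. Qed.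
Lemma bounded_op_past2_slow : bounded_op past2_slow.
Proof. by apply: bounded_op_past => //; exact: bounded_op_past_slow. Qed.
Lemma bounded_op_past_fast : bounded_op past_fast.
Proof. by rewrite /past_fast /fast1 /fast2; bounded_op_auto. Qed.
Lemma bounded_op_future_slow : bounded_op future_slow.
Proof. by rewrite /future_slow /slow1 /slow2; bounded_op_auto. Qed.
Lemma bounded_op_future_dslow : bounded_op future_dslow.
Proof. by rewrite /future_dslow /dslow1 /dslow2; bounded_op_auto. Qed.
Lemma bounded_op_future2_slow : bounded_op future2_slow.
Proof. by apply: bounded_op_future => //; exact: bounded_op_future_slow. Qed.
Lemma bounded_op_future_fast : bounded_op future_fast.
Proof. by rewrite /future_fast /fast1 /fast2; bounded_op_auto. Qed.

Let bounded_modes := (bounded_op_past_slow, bounded_op_past_dslow, bounded_op_past2_slow,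
  bounded_op_past_fast, bounded_op_future_slow,
  bounded_op_future_dslow, bounded_op_future2_slow, bounded_op_future_fast).

Lemma bounded_op_resolvent1 : bounded_op resolvent1.
Proof.
move: bounded_modes => [[[[[[[? ?] ?] ?] ?] ?] ?] ?].
by rewrite /resolvent1 /dslow1 /slow1 /fast1; bounded_op_auto.
Qed.
Lemma bounded_op_resolvent2 : bounded_op resolvent2.
Proof.
move: bounded_modes => [[[[[[[? ?] ?] ?] ?] ?] ?] ?].
by rewrite /resolvent2 /dslow2 /slow2 /fast2; bounded_op_auto.
Qed.
Lemma bounded_op_resolvent1_x : bounded_op resolvent1_x.
Proof.
move: bounded_modes => [[[[[[[? ?] ?] ?] ?] ?] ?] ?].
by rewrite /resolvent1_x /dslow1_x /slow1_x /fast1_x /dslow1 /slow1 /fast1; bounded_op_auto.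
Qed.
Lemma bounded_op_resolvent2_x : bounded_op resolvent2_x.
Proof.
move: bounded_modes => [[[[[[[? ?] ?] ?] ?] ?] ?] ?].
by rewrite /resolvent2_x /dslow2_x /slow2_x /fast2_x /dslow2 /slow2 /fast2; bounded_op_auto.
Qed.

Section Equation.
Variables (f1 f2 : R -> R) (M1 M2 : R).
Hypotheses (df1 : decay M1 f1) (df2 : decay M2 f2).

Lemma decay_comb (h k : R -> R) : multiplier h -> multiplier k ->
  exists N, decay N (fun s => h s * f1 s + k s * f2 s).
Proof.
move=> [ch [N hN]] [ck [P kP]]; eexists.
by apply: decayD; apply: decayM_bounded; eassumption.
Qed.

Lemma has_deriv_past_slow x : has_deriv (past_slow f1 f2) x
  (- slow1 (- tanh x) * f1 x + slow2 (- tanh x) * f2 x - past_slow f1 f2 x).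
Proof.
have [] := @decay_comb (fun s => - slow1 (- tanh s)) (fun s => slow2 (- tanh s)).
- by rewrite /slow1; multiplier_auto.
- by rewrite /slow2; multiplier_auto.
by move=> N /(has_deriv_past x (lexx 1)); rewrite mul1r.
Qed.

Lemma has_deriv_past_dslow x : has_deriv (past_dslow f1 f2) x
  (- dslow1 (- tanh x) * f1 x + dslow2 (- tanh x) * f2 x - past_dslow f1 f2 x).
Proof.
have [] := @decay_comb (fun s => - dslow1 (- tanh s)) (fun s => dslow2 (- tanh s)).
- by rewrite /dslow1; multiplier_auto.
- by rewrite /dslow2; multiplier_auto.
by move=> N /(has_deriv_past x (lexx 1)); rewrite mul1r.
Qed.

Lemma has_deriv_past_fast x : has_deriv (past_fast f1 f2) x
  (- fast1 (- tanh x) * f1 x + fast2 (- tanh x) * f2 x - l * past_fast f1 f2 x).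
Proof.
have [] := @decay_comb (fun s => - fast1 (- tanh s)) (fun s => fast2 (- tanh s)).
- by rewrite /fast1; multiplier_auto.
- by rewrite /fast2; multiplier_auto.
by move=> N /(has_deriv_past x l1).
Qed.

Lemma has_deriv_future_slow x : has_deriv (future_slow f1 f2) x
  (future_slow f1 f2 x - (slow1 (tanh x) * f1 x + slow2 (tanh x) * f2 x)).
Proof.
have [] := @decay_comb (fun s => slow1 (tanh s)) (fun s => slow2 (tanh s)).
- by rewrite /slow1; multiplier_auto.
- by rewrite /slow2; multiplier_auto.
by move=> N /(has_deriv_future x (lexx 1)); rewrite mul1r.
Qed.

Lemma has_deriv_future_dslow x : has_deriv (future_dslow f1 f2) x
  (future_dslow f1 f2 x - (dslow1 (tanh x) * f1 x + dslow2 (tanh x) * f2 x)).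
Proof.
have [] := @decay_comb (fun s => dslow1 (tanh s)) (fun s => dslow2 (tanh s)).
- by rewrite /dslow1; multiplier_auto.
- by rewrite /dslow2; multiplier_auto.
by move=> N /(has_deriv_future x (lexx 1)); rewrite mul1r.
Qed.

Lemma has_deriv_future_fast x : has_deriv (future_fast f1 f2) x
  (l * future_fast f1 f2 x - (fast1 (tanh x) * f1 x + fast2 (tanh x) * f2 x)).
Proof.
have [] := @decay_comb (fun s => fast1 (tanh s)) (fun s => fast2 (tanh s)).
- by rewrite /fast1; multiplier_auto.
- by rewrite /fast2; multiplier_auto.
by move=> N /(has_deriv_future x l1).
Qed.

Lemma has_deriv_past2_slow x :
  has_deriv (past2_slow f1 f2) x (past_slow f1 f2 x - past2_slow f1 f2 x).
Proof.
have [] := @decay_comb (fun s => - slow1 (- tanh s)) (fun s => slow2 (- tanh s)).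
- by rewrite /slow1; multiplier_auto.
- by rewrite /slow2; multiplier_auto.
by move=> N /(decay_past (lexx 1))/(has_deriv_past x (lexx 1)); rewrite mul1r.
Qed.

Lemma has_deriv_future2_slow x :
  has_deriv (future2_slow f1 f2) x (future2_slow f1 f2 x - future_slow f1 f2 x).
Proof.
have [] := @decay_comb (fun s => slow1 (tanh s)) (fun s => slow2 (tanh s)).
- by rewrite /slow1; multiplier_auto.
- by rewrite /slow2; multiplier_auto.
by move=> N /(decay_future (lexx 1))/(has_deriv_future x (lexx 1)); rewrite mul1r.
Qed.

Let nonzero : [/\ l != 0, 1 - Y != 0, 2 - Y != 0, 1 - 2 * Y != 0 &
  1 - Y + Y * Y != 0].
Proof.
have YY := mulr_ge0 Y0 Y0; move: Y0 Yh l1 => a b c.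
by split; rewrite gt_eqF//; lra.
Qed.

Ltac resolvent_derive :=
  match goal with |- has_deriv _ ?x _ =>
  have ? := has_deriv_tanh x; have ? := has_deriv_past_slow x;
  have ? := has_deriv_past_dslow x; have ? := has_deriv_past2_slow x;
  have ? := has_deriv_past_fast x; have ? := has_deriv_future_slow x;
  have ? := has_deriv_future_dslow x; have ? := has_deriv_future2_slow x;
  have ? := has_deriv_future_fast x
  end;
  rewrite /residue1 /residue2 /resolvent1 /resolvent2
    /resolvent1_x /resolvent2_x /kappa0 /kappa1 /kappa2
    /slow1_x /slow2_x /dslow1_x /dslow2_x /fast1_x /fast2_x
    /slow1 /slow2 /dslow1 /dslow2 /fast1 /fast2;
  derive_eq; rewrite /slow1 /slow2 /dslow1 /dslow2 /fast1 /fast2.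

(** The terms containing [f1] and [f2] cancel: the kernel is continuous across the diagonal. *)
Lemma has_deriv_resolvent1 x : has_deriv (resolvent1 f1 f2) x (resolvent1_x f1 f2 x).
Proof.
case: nonzero => n1 n2 n3 n4 n5; resolvent_derive.
by field: gY ll; rewrite n1 n2 n3 n4 n5.
Qed.

Lemma has_deriv_resolvent2 x : has_deriv (resolvent2 f1 f2) x (resolvent2_x f1 f2 x).
Proof.
case: nonzero => n1 n2 n3 n4 n5; resolvent_derive.
by field: gY ll; rewrite n1 n2 n3 n4 n5.
Qed.

(** Here the jump of the differentiated kernel across the diagonal contributes [2 * f1 x]. Together
    with its companion below, this is [E (K f) = residue]. *)
Lemma has_deriv_resolvent1_x x : has_deriv (resolvent1_x f1 f2) x
  (2 * (residue1 f1 f2 x - g * (resolvent2_x f1 f2 x - 2 * tanh x * resolvent2 f1 f2 x)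
        + (1 / 2 - Y - 1 + 3 * tanh x ^+ 2) * resolvent1 f1 f2 x)).
Proof.
case: nonzero => n1 n2 n3 n4 n5; resolvent_derive.
by field: gY ll; rewrite n1 n2 n3 n4 n5.
Qed.

Lemma has_deriv_resolvent2_x x : has_deriv (resolvent2_x f1 f2) x
  (2 * (residue2 f1 f2 x + g * (resolvent1_x f1 f2 x + 2 * tanh x * resolvent1 f1 f2 x)
        + (1 / 2 - Y - 1 + tanh x ^+ 2 + 2 * g * g) * resolvent2 f1 f2 x)).
Proof.
case: nonzero => n1 n2 n3 n4 n5; resolvent_derive.
by field: gY ll; rewrite n1 n2 n3 n4 n5.
Qed.

End Equation.
End Resolvent.

(** * A quadratic fixed point *)

Section FixedPoint.
Context {R : realType}.
Implicit Types (f u v : R -> R) (x M : R).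

Lemma le_geometric0 (a C : R) : (forall n, `|a| <= C / 2 ^+ n) -> a = 0.
Proof.
move=> h; apply/eqP; apply: contraT => a0; have na : 0 < `|a| by rewrite normr_gt0.
have C0 : 0 <= C by have := le_trans (ltW na) (h 0); rewrite expr0 divr1.
have Ca : 0 <= C / `|a| by rewrite divr_ge0.
have := archi_boundP Ca; set n := Num.bound _ => Cn.
have := h n; rewrite ler_pdivlMr ?exprn_gt0//.
have : C < `|a| * 2 ^+ n.
  rewrite mulrC -ltr_pdivrMr//; apply: lt_le_trans Cn _.
  by rewrite -natrX ler_nat ltnW// ltn_expl.
by move=> /lt_le_trans/[apply]; rewrite ltxx.
Qed.

(* The limit is the supremum of the increasing sequence [v n - 2 M / 2^n * ewt]. *)
Lemma decay_limit (v : nat -> R -> R) M :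
  (forall n, continuous (v n)) ->
  (forall n x, `|v n.+1 x - v n x| <= M / 2 ^+ n * ewt x) ->
  exists w, forall n, decay (2 * M / 2 ^+ n) (fun x => w x - v n x).
Proof.
move=> cv dv.
have p2 n : (0 : R) < 2 ^+ n by rewrite exprn_gt0.
pose r n x : R := 2 * M / 2 ^+ n * ewt x.
have rS n x : r n.+1 x = r n x - M / 2 ^+ n * ewt x.
  by rewrite /r exprS; field; rewrite gt_eqF.
have lo x n : v n x - r n x <= v n.+1 x - r n.+1 x.
  by have := dv n x; rewrite rS ler_norml => /andP[]; lra.
have hi x n : v n.+1 x + r n.+1 x <= v n x + r n x.
  by have := dv n x; rewrite rS ler_norml => /andP[]; lra.
have r0 n x : 0 <= r n x.
  have := le_trans (normr_ge0 _) (dv 0 x); rewrite expr0 divr1 => Me.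
  rewrite /r [leRHS](_ : _ = 2 * (M * ewt x) / 2 ^+ n); last by ring.
  by rewrite divr_ge0 ?(ltW (p2 n))// mulr_ge0.
have los x : {homo (fun n => v n x - r n x) : m n / (m <= n)%N >-> m <= n}.
  exact: homo_leq (@lexx _ _) (@le_trans _ _) (lo x).
have his x : {homo (fun n => v n x + r n x) : m n / (m <= n)%N >-> n <= m}.
  apply: (@homo_leq _ _ (fun a b => b <= a) _ _ (hi x)) => [a|b a c ba cb].
    exact: lexx.
  exact: le_trans cb ba.
have lohi x m n : v m x - r m x <= v n x + r n x.
  apply: le_trans (los x _ _ (leq_maxl m n)) _.
  apply: le_trans _ (his x _ _ (leq_maxr m n)).
  by have := r0 (maxn m n) x; lra.
pose E x := range (fun n => v n x - r n x).
have En x n : E x (v n x - r n x) by exists n.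
have Eub x n : ubound (E x) (v n x + r n x) by move=> _ [m _ <-].
have wr n x : `|sup (E x) - v n x| <= r n x.
  rewrite ler_norml; apply/andP; split.
    have : v n x - r n x <= sup (E x).
      by apply: ub_le_sup => //; exists (v 0 x + r 0 x).
    by lra.
  have : sup (E x) <= v n x + r n x by apply: ge_sup => //; exists (v n x - r n x).
  by lra.
exists (fun x => sup (E x)) => n; split; last by move=> x; exact: wr.
suff cw : continuous (fun x => sup (E x)).
  by move=> x; apply: cvgB; [exact: cw | exact: cv].
move=> x; apply/cvgrPdist_le => e e0.
(* As [8 * M / e < k <= 2 ^ k], the uniform error [2 * M / 2 ^ k] is at most [e / 4]; two such
   errors and the continuity of [v k] add up to [3 e / 4]. *)
pose k := Num.bound (8 * M / e).
have M0 : 0 <= M.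
  have := le_trans (normr_ge0 _) (dv 0 x); rewrite expr0 divr1.
  by rewrite pmulr_lge0// ewt_gt0.
have rk y : r k y <= e / 4.
  apply: (@le_trans _ _ (2 * M / 2 ^+ k)).
    by rewrite ler_piMr ?ewt_le1// divr_ge0 ?mulr_ge0 ?(ltW (p2 k)).
  rewrite ler_pdivrMr// [leRHS]mulrC -ler_pdivrMr; last by rewrite divr_gt0.
  rewrite [leLHS](_ : _ = 8 * M / e); last by field; rewrite gt_eqF.
  have Me : 0 <= 8 * M / e by rewrite divr_ge0 ?mulr_ge0 ?(ltW e0).
  apply: le_trans (ltW (archi_boundP Me)) _.
  by rewrite -natrX ler_nat ltnW// ltn_expl.
have /cvgrPdist_le /(_ (e / 4)) ck := cv k x.
have {}ck : \forall t \near x, `|v k x - v k t| <= e / 4.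
  by apply: ck; rewrite divr_gt0.
near=> t.
have vt : `|v k x - v k t| <= e / 4 by near: t; exact: ck.
have := le_trans (wr k t) (rk t); have := le_trans (wr k x) (rk x).
move: vt; rewrite !ler_norml => /andP[? ?] /andP[? ?] /andP[? ?].
by apply/andP; split; lra.
Unshelve. all: by end_near. Qed.

Definition bounded_form (L : (R -> R) -> (R -> R) -> R) : Prop :=
  (exists C, forall f1 f2 M, decay M f1 -> decay M f2 -> `|L f1 f2| <= C * M) /\
  (forall f1 f2 g1 g2 M N a b, decay M f1 -> decay M f2 ->
     decay N g1 -> decay N g2 ->
     L (fun s => a * f1 s + b * g1 s) (fun s => a * f2 s + b * g2 s) =
     a * L f1 f2 + b * L g1 g2).

Variables (K1 K2 : (R -> R) -> (R -> R) -> R -> R).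
Variable L : (R -> R) -> (R -> R) -> R.
Hypotheses (bK1 : bounded_op K1) (bK2 : bounded_op K2) (bL : bounded_form L).

(* The components of [L(u) J u - L(J u) u], where [J(a, b) = (b, -a)]. *)
Definition nl1 u1 u2 (s : R) : R :=
  L u1 u2 * u2 s - L u2 (fun s => - u1 s) * u1 s.
Definition nl2 u1 u2 (s : R) : R :=
  - L u1 u2 * u1 s - L u2 (fun s => - u1 s) * u2 s.

Lemma decayN M f : decay M f -> decay M (fun s => - f s).
Proof.
move=> df; have := decayZ (-1) df; rewrite normrN1 mul1r.
by under eq_fun do rewrite mulN1r.
Qed.

(** By linearity the value is the commutator [L(u) L(J u) - L(J u) L(u)] of two real numbers. *)
Lemma nl_annihilated u1 u2 M : decay M u1 -> decay M u2 ->
  L (nl1 u1 u2) (nl2 u1 u2) = 0.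
Proof.
move=> d1 d2; have [_ LL] := bL.
rewrite /nl1 /nl2; set a := L u1 u2; set b := L u2 _.
rewrite [X in L X _](_ : _ = fun s => a * u2 s + (- b) * u1 s); last first.
  by apply/funext => s; ring.
rewrite [X in L _ X](_ : _ = fun s => a * - u1 s + (- b) * u2 s); last first.
  by apply/funext => s; ring.
by rewrite (LL _ _ _ _ _ _ _ _ d2 (decayN d1) d1 d2) -/a -/b; ring.
Qed.

(** A constant at least [1] may later be inserted into products without decreasing them. *)
Lemma form_bound : exists2 D, 1 <= D &
  forall f1 f2 M, decay M f1 -> decay M f2 -> `|L f1 f2| <= D * M.
Proof.
have [[D hD] _] := bL; exists (`|D| + 1); first by rewrite lerDr.
move=> f1 f2 M d1 d2; apply: le_trans (hD _ _ _ d1 d2) _.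
rewrite ler_wpM2r ?(decay_ge0 d1)//; apply: le_trans (ler_norm _) _.
by rewrite lerDl.
Qed.

Lemma op_bound K : bounded_op K -> exists2 C, 1 <= C &
  forall f1 f2 M, decay M f1 -> decay M f2 -> decay (C * M) (K f1 f2).
Proof.
move=> [[C hC] _]; exists (`|C| + 1); first by rewrite lerDr.
move=> f1 f2 M d1 d2; apply: decay_le (hC _ _ _ d1 d2).
rewrite ler_wpM2r ?(decay_ge0 d1)//; apply: le_trans (ler_norm _) _.
by rewrite lerDl.
Qed.

Section Bounds.
Variable D : R.
Hypothesis D1 : 1 <= D.
Hypothesis LD : forall f1 f2 M, decay M f1 -> decay M f2 -> `|L f1 f2| <= D * M.

Lemma decay_nl u1 u2 M : decay M u1 -> decay M u2 ->
  decay (2 * D * M * M) (nl1 u1 u2) /\ decay (2 * D * M * M) (nl2 u1 u2).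
Proof.
move=> d1 d2; have M0 := decay_ge0 d1.
have e1 := LD d1 d2; have e2 := LD d2 (decayN d1).
have le a f : `|a| <= D * M -> decay M f -> decay (D * M * M) (fun s => a * f s).
  by move=> aD df; apply: decay_le (decayZ a df); rewrite ler_wpM2r.
have e1' : `|- L u1 u2| <= D * M by rewrite normrN.
by split; rewrite [2 * D * M * M](_ : _ = D * M * M + D * M * M);
  [apply: decayD; [|apply: decayN]; exact: le | ring |
   apply: decayD; [|apply: decayN]; exact: le | ring].
Qed.

(** Each product telescopes as [L(u) (u - v) + L(u - v) v], and likewise with [J]; each of the four
    resulting terms is bounded by [D * M * e]. *)
Lemma decay_nl_diff u1 u2 v1 v2 M e : decay M u1 -> decay M u2 ->
  decay M v1 -> decay M v2 ->
  decay e (fun s => u1 s - v1 s) -> decay e (fun s => u2 s - v2 s) ->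
  decay (4 * D * M * e) (fun s => nl1 u1 u2 s - nl1 v1 v2 s) /\
  decay (4 * D * M * e) (fun s => nl2 u1 u2 s - nl2 v1 v2 s).
Proof.
move=> d1 d2 b1 b2 e1 e2; have M0 := decay_ge0 d1; have e0 := decay_ge0 e1.
have [_ LL] := bL.
have D0 : 0 <= D := le_trans ler01 D1.
have E1 : L (fun s => u1 s - v1 s) (fun s => u2 s - v2 s) = L u1 u2 - L v1 v2.
  have := LL _ _ _ _ _ _ 1 (-1) d1 d2 b1 b2; rewrite mul1r mulN1r => <-.
  by congr L; apply/funext => s; ring.
have E2 : L (fun s => u2 s - v2 s) (fun s => - (u1 s - v1 s)) =
    L u2 (fun s => - u1 s) - L v2 (fun s => - v1 s).
  have := LL _ _ _ _ _ _ 1 (-1) d2 (decayN d1) b2 (decayN b1).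
  rewrite mul1r mulN1r => <-.
  by congr L; apply/funext => s; ring.
have l1 := LD d1 d2; have l2 := LD d2 (decayN d1).
have l3 := LD e1 e2; have l4 := LD e2 (decayN e1).
have le1 a f : `|a| <= D * M -> decay e f -> decay (D * M * e) (fun s => a * f s).
  by move=> aD df; apply: decay_le (decayZ a df); rewrite ler_wpM2r.
have le2 a f : `|a| <= D * e -> decay M f -> decay (D * M * e) (fun s => a * f s).
  by move=> aD df; apply: decay_le (decayZ a df); rewrite mulrAC ler_wpM2r.
rewrite [4 * D * M * e](_ : _ = D * M * e + D * M * e + (D * M * e + D * M * e));
  last by ring.
split.
- rewrite [X in decay _ X](_ : _ = fun s =>
    L u1 u2 * (u2 s - v2 s)
    + L (fun s => u1 s - v1 s) (fun s => u2 s - v2 s) * v2 s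
    + (- (L u2 (fun s => - u1 s) * (u1 s - v1 s))
       + - (L (fun s => u2 s - v2 s) (fun s => - (u1 s - v1 s)) * v1 s))).
    apply: decayD; apply: decayD.
    + exact: le1.
    + exact: le2.
    + by apply: decayN; exact: le1.
    + by apply: decayN; exact: le2.
  by apply/funext => s; rewrite E1 E2 /nl1; ring.
- rewrite [X in decay _ X](_ : _ = fun s =>
    - (L u1 u2 * (u1 s - v1 s))
    + - (L (fun s => u1 s - v1 s) (fun s => u2 s - v2 s) * v1 s)
    + (- (L u2 (fun s => - u1 s) * (u2 s - v2 s))
       + - (L (fun s => u2 s - v2 s) (fun s => - (u1 s - v1 s)) * v2 s))).
    apply: decayD; apply: decayD; apply: decayN.
    + exact: le1.
    + exact: le2.
    + exact: le1.
    + exact: le2.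
  by apply/funext => s; rewrite E1 E2 /nl2; ring.
Qed.

End Bounds.

Lemma quadratic_fixed_point (phi1 phi2 : R -> R) (A eps : R) :
  decay A phi1 -> decay A phi2 -> 0 < eps ->
  exists s u1 u2,
    [/\ 0 < s <= eps,
      forall x, u1 x = phi1 x + s * K1 (nl1 u1 u2) (nl2 u1 u2) x,
      forall x, u2 x = phi2 x + s * K2 (nl1 u1 u2) (nl2 u1 u2) x,
      decay eps (fun x => u1 x - phi1 x) &
      decay eps (fun x => u2 x - phi2 x)].
Proof.
(* With [A >= 1], the single smallness condition on [s * (C * D * A * A)] also controls
   [s * (C * D * A)] and [s] itself. *)
wlog A1 : A / 1 <= A => [hw d1 d2|d1 d2 eps0].
  apply: (hw (A + 1)); first by rewrite lerDr (decay_ge0 d1).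
    by apply: decay_le d1; rewrite lerDl.
  by apply: decay_le d2; rewrite lerDl.
have [D D1 LD] := form_bound.
have [C1 C11 KC1] := op_bound bK1; have [C2 C21 KC2] := op_bound bK2.
pose C := C1 + C2.
have C10 : 1 <= C by rewrite /C; lra.
have {}KC1 f1 f2 M : decay M f1 -> decay M f2 -> decay (C * M) (K1 f1 f2).
  move=> e1 e2; apply: decay_le (KC1 _ _ _ e1 e2).
  by rewrite ler_wpM2r ?(decay_ge0 e1)// /C; lra.
have {}KC2 f1 f2 M : decay M f1 -> decay M f2 -> decay (C * M) (K2 f1 f2).
  move=> e1 e2; apply: decay_le (KC2 _ _ _ e1 e2).
  by rewrite ler_wpM2r ?(decay_ge0 e1)// /C; lra.
have [C0 D0 A0] : [/\ 0 < C, 0 < D & 0 < A] by split; lra.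
have Q0 : 0 < C * D * A * A by rewrite !mulr_gt0.
have m0 : 0 < Num.min 1 eps by rewrite lt_min ltr01.
(* The strictest requirement sets the constant: in the ball of radius [4 * A], the correction is at
   most [s * C * (2 * D) * (4 * A) ^ 2 = 32 * s * (C * D * A * A)], which has to be at most [eps].
   On the iterates, of size [2 * A], the Lipschitz constant [8 * s * C * D * A] is then at most
   [1/4], below the ratio [1/2] used. *)
have [s [s0 sQ]] : exists s : R, 0 < s /\ 32 * s * (C * D * A * A) = Num.min 1 eps.
  exists (Num.min 1 eps / (32 * (C * D * A * A))); split.
    by rewrite divr_gt0// mulr_gt0.
  by move: (C * D * A * A) Q0 => Q Q0; field; rewrite gt_eqF.
have sQ1 : 32 * s * (C * D * A * A) <= 1 by rewrite sQ ge_min lexx.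
have sQe : 32 * s * (C * D * A * A) <= eps by rewrite sQ ge_min lexx orbT.
have sQA : 32 * s * (C * D * A) <= 1.
  apply: le_trans _ sQ1; rewrite !mulrA ler_peMr// ltW//.
  by rewrite !mulr_gt0.
pose step (p : (R -> R) * (R -> R)) :=
  ((fun x => phi1 x + s * K1 (nl1 p.1 p.2) (nl2 p.1 p.2) x),
   (fun x => phi2 x + s * K2 (nl1 p.1 p.2) (nl2 p.1 p.2) x)).
pose u (n : nat) := iter n step (phi1, phi2).
have sd f M N : s * M <= N -> decay M f -> decay N (fun x => s * f x).
  by move=> sMN df; apply: decay_le (decayZ s df); rewrite (gtr0_norm s0).
have du n : decay (2 * A) (u n).1 /\ decay (2 * A) (u n).2.
  elim: n => [|n [i1 i2]]; first by split=> /=; [apply: decay_le d1|apply: decay_le d2]; lra.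
  have [n1 n2] := decay_nl LD i1 i2.
  have b : s * (C * (2 * D * (2 * A) * (2 * A))) <= A.
    by rewrite [leLHS](_ : _ = 8 * s * (C * D * A * A)); [lra | ring].
  rewrite (_ : 2 * A = A + A); last by ring.
  by split=> /=; apply: decayD => //; apply: sd b _; [exact: KC1 | exact: KC2].
have diff n : decay (A / 2 ^+ n) (fun x => (u n.+1).1 x - (u n).1 x) /\
              decay (A / 2 ^+ n) (fun x => (u n.+1).2 x - (u n).2 x).
  elim: n => [|n [i1 i2]].
    have [n1 n2] := decay_nl LD d1 d2.
    have b : s * (C * (2 * D * A * A)) <= A / 2 ^+ 0.
      by rewrite expr0 divr1 [leLHS](_ : _ = 2 * s * (C * D * A * A)); [lra | ring].
    split => /=.
      under eq_fun do rewrite addrC addKr; apply: sd b _; exact: KC1.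
    under eq_fun do rewrite addrC addKr; apply: sd b _; exact: KC2.
  have [a1 a2] := du n.+1; have [b1 b2] := du n.
  have [n1 n2] := decay_nl_diff D1 LD a1 a2 b1 b2 i1 i2.
  have b : s * (C * (4 * D * (2 * A) * (A / 2 ^+ n))) <= A / 2 ^+ n.+1.
    rewrite exprS invfM [leRHS](_ : _ = 2^-1 * (A / 2 ^+ n)); last by ring.
    rewrite [leLHS](_ : _ = 8 * s * (C * D * A) * (A / 2 ^+ n)); last by ring.
    by rewrite ler_wpM2r ?divr_ge0//; lra.
  have [N1 N2] := decay_nl LD a1 a2; have [P1 P2] := decay_nl LD b1 b2.
  split.
    rewrite [X in decay _ X](_ : _ = fun x => s * K1
      (fun y => 1 * nl1 (u n.+1).1 (u n.+1).2 y + (-1) * nl1 (u n).1 (u n).2 y)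
      (fun y => 1 * nl2 (u n.+1).1 (u n.+1).2 y + (-1) * nl2 (u n).1 (u n).2 y) x).
      apply: sd b _; apply: KC1.
        by under eq_fun do rewrite mul1r mulN1r.
      by under eq_fun do rewrite mul1r mulN1r.
    by apply/funext => x; rewrite (bK1.2 _ _ _ _ _ _ _ _ _ N1 N2 P1 P2) /=; ring.
  rewrite [X in decay _ X](_ : _ = fun x => s * K2
    (fun y => 1 * nl1 (u n.+1).1 (u n.+1).2 y + (-1) * nl1 (u n).1 (u n).2 y)
    (fun y => 1 * nl2 (u n.+1).1 (u n.+1).2 y + (-1) * nl2 (u n).1 (u n).2 y) x).
    apply: sd b _; apply: KC2.
      by under eq_fun do rewrite mul1r mulN1r.
    by under eq_fun do rewrite mul1r mulN1r.
  by apply/funext => x; rewrite (bK2.2 _ _ _ _ _ _ _ _ _ N1 N2 P1 P2) /=; ring.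
have [w1 lim1] := decay_limit (fun n => (du n).1.1) (fun n => (diff n).1.2).
have [w2 lim2] := decay_limit (fun n => (du n).2.1) (fun n => (diff n).2.2).
(* The limit is within [2 * A] of the initial [phi1], itself of size [A]; [3 * A] is rounded up to
   [4 * A]. *)
have dw1 : decay (4 * A) w1.
  rewrite (_ : w1 = fun x => (w1 x - (u 0).1 x) + (u 0).1 x); last first.
    by apply/funext => x; rewrite subrK.
  by apply: decay_le (decayD (lim1 0) (du 0).1); rewrite expr0; lra.
have dw2 : decay (4 * A) w2.
  rewrite (_ : w2 = fun x => (w2 x - (u 0).2 x) + (u 0).2 x); last first.
    by apply/funext => x; rewrite subrK.
  by apply: decay_le (decayD (lim2 0) (du 0).2); rewrite expr0; lra.
have [W1 W2] := decay_nl LD dw1 dw2.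
have b : s * (C * (2 * D * (4 * A) * (4 * A))) <= eps.
  by rewrite [leLHS](_ : _ = 32 * s * (C * D * A * A)); last by ring.
(* The limit solves the equation up to [w - u (n + 1)] plus the change of the quadratic term between
   [u n] and [w]. Both decay like [2 ^- n], so the defect, independent of [n], vanishes. *)
have err n : decay (5 * A / 2 ^+ n)
    (fun x => w1 x - (phi1 x + s * K1 (nl1 w1 w2) (nl2 w1 w2) x)) /\
  decay (5 * A / 2 ^+ n)
    (fun x => w2 x - (phi2 x + s * K2 (nl1 w1 w2) (nl2 w1 w2) x)).
  have v1 : decay (4 * A) (u n).1 by apply: decay_le (du n).1; lra.
  have v2 : decay (4 * A) (u n).2 by apply: decay_le (du n).2; lra.
  have swap (f h : R -> R) e : decay e (fun x => f x - h x) -> decay e (fun x => h x - f x).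
    by move=> /decayN; under eq_fun do rewrite opprB.
  have [n1 n2] := decay_nl_diff D1 LD v1 v2 dw1 dw2 (swap _ _ _ (lim1 n)) (swap _ _ _ (lim2 n)).
  have [N1 N2] := decay_nl LD v1 v2.
  have c : s * (C * (4 * D * (4 * A) * (2 * A / 2 ^+ n))) <= A / 2 ^+ n.
    rewrite [leLHS](_ : _ = 32 * s * (C * D * A) * (A / 2 ^+ n)); last by ring.
    by rewrite ler_piMl// divr_ge0//; lra.
  have c' : 2 * A / 2 ^+ n.+1 + A / 2 ^+ n <= 5 * A / 2 ^+ n.
    rewrite exprS invfM.
    have : 0 <= A / 2 ^+ n by rewrite divr_ge0//; lra.
    by rewrite !mulrA -!(mulrC (2 ^+ n)^-1); lra.
  split.
    rewrite [X in decay _ X](_ : _ = fun x => (w1 x - (u n.+1).1 x) + s * K1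
      (fun y => 1 * nl1 (u n).1 (u n).2 y + (-1) * nl1 w1 w2 y)
      (fun y => 1 * nl2 (u n).1 (u n).2 y + (-1) * nl2 w1 w2 y) x).
      apply: decay_le c' _; apply: decayD (lim1 n.+1) _.
      apply: sd c _; apply: KC1.
        by under eq_fun do rewrite mul1r mulN1r.
      by under eq_fun do rewrite mul1r mulN1r.
    by apply/funext => x; rewrite (bK1.2 _ _ _ _ _ _ _ _ _ N1 N2 W1 W2) /=; ring.
  rewrite [X in decay _ X](_ : _ = fun x => (w2 x - (u n.+1).2 x) + s * K2
    (fun y => 1 * nl1 (u n).1 (u n).2 y + (-1) * nl1 w1 w2 y)
    (fun y => 1 * nl2 (u n).1 (u n).2 y + (-1) * nl2 w1 w2 y) x).
    apply: decay_le c' _; apply: decayD (lim2 n.+1) _.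
    apply: sd c _; apply: KC2.
      by under eq_fun do rewrite mul1r mulN1r.
    by under eq_fun do rewrite mul1r mulN1r.
  by apply/funext => x; rewrite (bK2.2 _ _ _ _ _ _ _ _ _ N1 N2 W1 W2) /=; ring.
have eq1 x : w1 x = phi1 x + s * K1 (nl1 w1 w2) (nl2 w1 w2) x.
  apply/eqP; rewrite -subr_eq0; apply/eqP.
  apply: (@le_geometric0 _ (5 * A)) => n; apply: le_trans ((err n).1.2 x) _.
  by rewrite ler_piMr ?ewt_le1// (decay_ge0 (err n).1).
have eq2 x : w2 x = phi2 x + s * K2 (nl1 w1 w2) (nl2 w1 w2) x.
  apply/eqP; rewrite -subr_eq0; apply/eqP.
  apply: (@le_geometric0 _ (5 * A)) => n; apply: le_trans ((err n).2.2 x) _.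
  by rewrite ler_piMr ?ewt_le1// (decay_ge0 (err n).2).
exists s, w1, w2; split => //.
- rewrite s0/=; apply: le_trans sQe; rewrite mulrAC ler_peMl ?(ltW s0)//.
  have CD : 1 <= C * D by rewrite mulr_ege1.
  have CDA : 1 <= C * D * A * A by rewrite !mulr_ege1.
  lra.
- rewrite [X in decay _ X](_ : _ = fun x => s * K1 (nl1 w1 w2) (nl2 w1 w2) x).
    by apply: sd b _; exact: KC1.
  by apply/funext => x; rewrite {1}eq1; ring.
- rewrite [X in decay _ X](_ : _ = fun x => s * K2 (nl1 w1 w2) (nl2 w1 w2) x).
    by apply: sd b _; exact: KC2.
  by apply/funext => x; rewrite {1}eq2; ring.
Qed.

End FixedPoint.

(** * Sobolev regularity *)

Section Sobolev.
Context {R : realType}.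
Implicit Types (f df phi : R -> R) (x M a : R).
Local Notation mu := (@lebesgue_measure R).

Lemma continuous_sqr_exp a M :
  continuous (fun x => (M * expR (- (a * `|x|))) ^+ 2).
Proof.
move=> x; apply: (@continuous_comp _ _ _ (fun x : R => `|x|)
  (fun x => (M * expR (- (a * x))) ^+ 2)); first exact: norm_continuous.
pose d := fun x => M * expR (- (a * x)) * (M * expR (- (a * x))).
apply: (@has_deriv_continuous _ d).
by rewrite /d; derive_auto.
Qed.

Lemma integral_sqr_exp_lty a M : 0 < a ->
  (\int[mu]_x ((M * expR (- (a * `|x|))) ^+ 2)%:E < +oo)%E.
Proof.
move=> a0; rewrite (ge0_symfun_integralT _ (@continuous_sqr_exp a M)).
- rewrite lte_mul_pinfty// -set_itvcy.
  have E s : s \in `[0, +oo[%classic -> ((M * expR (- (a * `|s|))) ^+ 2)%:E =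
      ((M ^+ 2)%:E * (expR (- (2 * a * s)))%:E)%E.
    rewrite inE/= in_itv/= andbT => s0.
    rewrite -EFinM (ger0_norm s0) exprMn; congr (_ * _)%:E.
    by rewrite -expRM_natl; congr expR; ring.
  under eq_integral => s s0 do rewrite (E s s0).
  rewrite ge0_integralZl_EFin ?sqr_ge0//.
  + by rewrite integral_expR_future ?mulr_gt0// -EFinM ltry.
  + apply/measurable_EFinP; apply: measurable_funTS.
    apply: continuous_measurable_fun => s.
    by apply: (@has_deriv_continuous _ (fun s => expR (- (2 * a * s)))); derive_auto.
- by move=> x; exact: sqr_ge0.
- by move=> x /=; rewrite normrN.
Qed.

Lemma L2_exp f a M : 0 < a -> continuous f ->
  (forall x, `|f x| <= M * expR (- (a * `|x|))) -> L2 f.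
Proof.
move=> a0 cf fM.
have mf : measurable_fun setT f by exact: continuous_measurable_fun.
rewrite /L2 inE; apply/andP; split; rewrite inE/=; first exact: mf.
rewrite /finite_norm unlock poweR_lty//.
apply: le_lt_trans (integral_sqr_exp_lty M a0).
apply: ge0_le_integral => //=.
- apply/measurable_EFinP.
  apply/(@measurableT_comp _ _ _ _ _ _ (fun x : R => x `^ 2)%R) => //.
  exact/measurableT_comp.
- apply/measurable_EFinP; apply: continuous_measurable_fun => x.
  exact: continuous_sqr_exp.
- move=> x _; rewrite lee_fin powR_mulrn//.
  by rewrite ler_pXn2r ?nnegrE//; exact: le_trans (normr_ge0 _) (fM x).
Qed.

Lemma test_function_near0 phi x : ~ closure [set y | phi y != 0] x ->
  \forall y \near x, phi y = 0.
Proof.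
move=> nx.
have : nbhs x (~` closure [set y | phi y != 0]).
  apply: open_nbhs_nbhs; split=> //.
  exact/closed_openC/closed_closure.
apply: filterS => y ny; apply: contra_notP ny => /eqP py.
exact: subset_closure.
Qed.

Lemma derive1_near0 phi x : (\forall y \near x, phi y = 0) -> derive1 phi x = 0.
Proof.
by move=> h; rewrite derive1E (@near_eq_derive _ _ _ phi (cst 0) _ _ h) derive_cst.
Qed.

(** This lets the second weak derivative be obtained by two integrations by parts, the first one
    tested against [derive1 phi]. *)
Lemma test_function_derive1 phi : test_function phi ->
  test_function (derive1 phi).
Proof.
move=> [dphi cphi]; split; first by move=> n x; rewrite -derive1Sn.
apply: (subclosed_compact _ cphi); first exact: closed_closure.
rewrite [X in _ `<=` X](closure_id _).1; last exact: closed_closure.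
apply: closureS => x /=; apply: contra_neqP => nx.
exact/derive1_near0/test_function_near0.
Qed.

Lemma weak_derivative1 f df : (forall x, has_deriv f x (df x)) ->
  continuous df -> weak_derivative 1 f df.
Proof.
move=> fd cdf phi tphi; have [dphi cphi] := tphi.
have [B [Breal hB]] := compact_bounded cphi.
pose A := `|B| + 1.
have A0 : 0 < A by rewrite ltr_wpDl.
have supp x : A < `|x| -> \forall y \near x, phi y = 0.
  move=> Ax; apply: test_function_near0 => cx.
  have BA : B < A by rewrite (le_lt_trans (ler_norm B))// ltrDl.
  have xA : `|x| <= A := hB A BA x cx.
  by rewrite leNgt Ax in xA.
have cphi0 : continuous phi.
  move=> x; apply: differentiable_continuous; apply/derivable1_diffP.
  exact: (dphi 0 x).
have cphi1 : continuous (derive1 phi).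
  move=> x; apply: differentiable_continuous; apply/derivable1_diffP.
  exact: (dphi 1 x).
have cf : continuous f by move=> x; exact: has_deriv_continuous (fd x).
have phi0 x : A < `|x| -> phi x = 0 by move=> /supp /nbhs_singleton.
have phi1 x : A < `|x| -> derive1 phi x = 0 by move=> /supp /derive1_near0.
(* The interval reaches [1] beyond [A], so that [phi] vanishes at both ends and the boundary terms
   drop out. *)
have restrict (h : R -> R) : (forall x, A < `|x| -> h x = 0) ->
    Rintegral mu setT h = Rintegral mu `[- (A + 1), A + 1] h.
  move=> h0; rewrite [RHS]Rintegral_mkcond; congr Rintegral.
  apply/funext => x; rewrite patchE; case: ifPn => //.
  rewrite notin_setE/= in_itv/= => /negP; rewrite -ler_norml -ltNge => Ax.
  by rewrite h0// (lt_trans _ Ax)// ltrDl.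
rewrite !restrict; last 2 first.
- by move=> x /phi0 ->; rewrite mulr0.
- by move=> x /phi1 E; rewrite /derive1n/= E mulr0.
rewrite (@Rintegration_by_parts _ f phi df (derive1 phi)).
- rewrite !phi0 ?mulr0 ?subrr ?sub0r ?expr1 ?mulN1r//.
  + by rewrite normrN ger0_norm ?ltrDl// addr_ge0// ltW.
  + by rewrite ger0_norm ?ltrDl// addr_ge0// ltW.
- by rewrite ltrNl opprD; lra.
- exact: continuous_subspaceT.
- split; first by move=> x _; exact: has_deriv_derivable (fd x).
  + by apply: cvg_at_right_filter; exact: cf.
  + by apply: cvg_at_left_filter; exact: cf.
- by move=> x _; exact: has_deriv_derive1 (fd x).
- exact: continuous_subspaceT.
- split; first by move=> x _; exact: (dphi 0 x).
  + by apply: cvg_at_right_filter; exact: cphi0.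
  + by apply: cvg_at_left_filter; exact: cphi0.
- by [].
Qed.

Lemma weak_derivative2 f df ddf : (forall x, has_deriv f x (df x)) ->
  (forall x, has_deriv df x (ddf x)) -> continuous ddf ->
  weak_derivative 2 f ddf.
Proof.
move=> fd dfd cddf phi tphi.
have cdf : continuous df by move=> x; exact: has_deriv_continuous (dfd x).
have := weak_derivative1 fd cdf (test_function_derive1 tphi).
rewrite /derive1n/= => ->.
have := weak_derivative1 dfd cddf tphi; rewrite /derive1n/= => ->.
by rewrite mulrA expr1 expr2.
Qed.

Lemma H2_exp f df ddf a M : 0 < a ->
  (forall x, has_deriv f x (df x)) -> (forall x, has_deriv df x (ddf x)) ->
  continuous ddf ->
  (forall x, `|f x| <= M * expR (- (a * `|x|))) ->
  (forall x, `|df x| <= M * expR (- (a * `|x|))) ->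
  (forall x, `|ddf x| <= M * expR (- (a * `|x|))) ->
  H2 f df ddf.
Proof.
move=> a0 fd dfd cddf bf bdf bddf.
have cdf : continuous df by move=> x; exact: has_deriv_continuous (dfd x).
have cf : continuous f by move=> x; exact: has_deriv_continuous (fd x).
split; [exact: L2_exp a0 _ bf | exact: L2_exp a0 _ bdf | exact: L2_exp a0 _ bddf | |].
- exact: weak_derivative1.
- exact: weak_derivative2 fd dfd cddf.
Qed.

(** By continuity [f] has no zero on some []0, e[], which is not a null set. *)
Lemma not_ae_eq0 f : continuous f -> f 0 != 0 ->
  ~ {ae mu, forall x, f x = 0}.
Proof.
move=> cf f0 [N [mN N0 sN]].
have /cvgrPdist_lt /(_ `|f 0|) near0 := cf 0.
have : \forall t \near (0 : R), `|f 0 - f t| < `|f 0|.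
  by apply: near0; rewrite normr_gt0.
move=> /nbhs_ballP[e /= e0 he].
have sub : `]0, e[%classic `<=` N.
  move=> t /=; rewrite in_itv/= => /andP[t0 te]; apply: sN => /= ft.
  have := he t; rewrite /ball/= sub0r normrN gtr0_norm// => /(_ te).
  by rewrite ft subr0 ltxx.
have : (mu `]0%R, e[ <= mu N)%E by apply: le_measure; rewrite ?inE.
rewrite N0 lebesgue_measure_itv/= lte_fin e0 sube0 lee_fin => e0'.
by have := lt_le_trans e0 e0'; rewrite ltxx.
Qed.

End Sobolev.

(** * The unstable mode *)

Section Mode.
Context {R : realType}.
Implicit Types (f : R -> R) (x M : R).

Lemma bounded_form_at0 (K : (R -> R) -> (R -> R) -> R -> R) :
  bounded_op K -> bounded_form (fun f1 f2 => K f1 f2 0).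
Proof.
move=> [[C KC] KL]; split.
  exists C => f1 f2 M d1 d2; apply: le_trans ((KC _ _ _ d1 d2).2 0) _.
  by rewrite ler_piMr ?ewt_le1// (decay_ge0 (KC _ _ _ d1 d2)).
by move=> f1 f2 g1 g2 M N a b d1 d2 e1 e2; exact: KL d1 d2 e1 e2.
Qed.

Definition decaying f : Prop := exists M, decay M f.

Lemma decayingD f h : decaying f -> decaying h -> decaying (fun x => f x + h x).
Proof. by move=> [M dM] [N dN]; exists (M + N); exact: decayD. Qed.

Lemma decayingN f : decaying f -> decaying (fun x => - f x).
Proof. by move=> [M dM]; exists M; exact: decayN. Qed.

Lemma decayingM h f : multiplier h -> decaying f -> decaying (fun x => h x * f x).
Proof. by move=> [ch [N hN]] [M dM]; exists (N * M); exact: decayM_bounded. Qed.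

Section FixedParameters.
Variables (g Y l : R).
Hypotheses (Y0 : 0 <= Y) (Yh : Y < 1 / 2).
Hypothesis gY : Y * Y = 2 * Y - g * g + 2 * g * g * Y.
Hypothesis l1 : 1 <= l.
Hypothesis ll : l * l = 5 - 4 * Y.

Definition phi1 x : R := 3 * g * tanh x * sech x.
Definition phi2 x : R := - (2 - Y) * sech x.
Definition dphi1 x : R := 3 * g * (1 - 2 * (tanh x * tanh x)) * sech x.
Definition dphi2 x : R := (2 - Y) * tanh x * sech x.

Lemma has_deriv_phi1 x : has_deriv phi1 x (dphi1 x).
Proof.
have dt := has_deriv_tanh x; have ds := has_deriv_sech x.
by rewrite /phi1 /dphi1; derive_eq; ring.
Qed.

Lemma has_deriv_phi2 x : has_deriv phi2 x (dphi2 x).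
Proof.
have ds := has_deriv_sech x.
by rewrite /phi2 /dphi2; derive_eq; ring.
Qed.

Lemma has_deriv_dphi1 x : has_deriv dphi1 x
  (2 * (- g * (dphi2 x - 2 * tanh x * phi2 x)
        + (1 / 2 - Y - 1 + 3 * tanh x ^+ 2) * phi1 x)).
Proof.
have dt := has_deriv_tanh x; have ds := has_deriv_sech x.
by rewrite /phi1 /phi2 /dphi1 /dphi2; derive_eq; field: gY.
Qed.

(** The equation of the second component for [E phi = 0]. After division by [sech], what remains is
    exactly the dispersion relation [gY]: this is what fixes the frequency [1/2 - Y]. *)
Lemma has_deriv_dphi2 x : has_deriv dphi2 x
  (2 * (g * (dphi1 x + 2 * tanh x * phi1 x)
        + (1 / 2 - Y - 1 + tanh x ^+ 2 + 2 * g * g) * phi2 x)).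
Proof.
have dt := has_deriv_tanh x; have ds := has_deriv_sech x.
by rewrite /phi1 /phi2 /dphi1 /dphi2; derive_eq; field: gY.
Qed.

Lemma decaying_phi1 : decaying phi1.
Proof.
apply: (decayingM (h := fun x => 3 * g * tanh x)); last by exists 2; exact: decay_sech.
multiplier_auto.
Qed.

Lemma decaying_phi2 : decaying phi2.
Proof.
apply: (decayingM (h := fun x => - (2 - Y))); last by exists 2; exact: decay_sech.
multiplier_auto.
Qed.

Lemma decaying_dphi1 : decaying dphi1.
Proof.
apply: (decayingM (h := fun x => 3 * g * (1 - 2 * (tanh x * tanh x))));
  last by exists 2; exact: decay_sech.
multiplier_auto.
Qed.

Lemma decaying_dphi2 : decaying dphi2.
Proof.
apply: (decayingM (h := fun x => (2 - Y) * tanh x)); last by exists 2; exact: decay_sech.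
multiplier_auto.
Qed.

(* The scalar product with [(phi1, phi2)], split at [0]. *)
Definition pairing (f1 f2 : R -> R) : R := past_slow g Y f1 f2 0 + future_slow g Y f1 f2 0.

Lemma bounded_form_pairing : bounded_form pairing.
Proof.
exact: (bounded_form_at0 (bounded_opD (bounded_op_past_slow g Y) (bounded_op_future_slow g Y))).
Qed.

(** At [r = 1] the slow solution and its reflection are both equal to [phi], because [exp (- x) (1 +
    tanh x) = exp x (1 - tanh x) = sech x]. Hence [h] is the integral of [phi . f] over the line
    split at [t], and its derivative in [t] vanishes. The coincidence is also what makes the Green
    function singular there. *)
Lemma pairing_kernel f1 f2 M x : decay M f1 -> decay M f2 ->
  slow1 g (tanh x) * past_slow g Y f1 f2 x - slow1 g (- tanh x) * future_slow g Y f1 f2 x =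
    phi1 x * pairing f1 f2 /\
  slow2 Y (tanh x) * past_slow g Y f1 f2 x + slow2 Y (- tanh x) * future_slow g Y f1 f2 x =
    phi2 x * pairing f1 f2.
Proof.
move=> d1 d2.
pose h t := expR t * past_slow g Y f1 f2 t + expR (- t) * future_slow g Y f1 f2 t.
have dh (t : R) : is_derive t 1 h 0.
  have dy := has_deriv_past_slow g Y d1 d2 t; have dx := has_deriv_future_slow g Y d1 d2 t.
  rewrite -/(has_deriv h t 0) /h; derive_eq.
  rewrite /slow1 /slow2.
  have e1 : expR t * (1 - tanh t) = expR (- t) * (1 + tanh t).
    by rewrite -sechE -sechEN.
  transitivity ((expR t * (1 - tanh t) - expR (- t) * (1 + tanh t)) *
    (3 * g * tanh t * f1 t - (2 - Y) * f2 t)); first ring.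
  by rewrite e1 subrr mul0r.
have hl : pairing f1 f2 = h x.
  by rewrite (is_derive_0_is_cst x 0 dh) /h /pairing oppr0 expR0 !mul1r.
rewrite hl /h /phi1 /phi2 /slow1 /slow2.
have a1 : sech x * expR x = 1 + tanh x.
  by rewrite sechEN mulrAC -expRD addNr expR0 mul1r.
have a2 : sech x * expR (- x) = 1 - tanh x.
  by rewrite sechE mulrAC -expRD subrr expR0 mul1r.
split.
  transitivity (3 * g * tanh x * ((sech x * expR x) * past_slow g Y f1 f2 x
    + (sech x * expR (- x)) * future_slow g Y f1 f2 x)); last ring.
  by rewrite a1 a2; ring.
transitivity (- (2 - Y) * ((sech x * expR x) * past_slow g Y f1 f2 x
    + (sech x * expR (- x)) * future_slow g Y f1 f2 x)); last ring.
by rewrite a1 a2; ring.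
Qed.

(** The two terms are the integrals of [phi1^2 + phi2^2] over the half-lines, with a factor [exp s]
    or [exp (- s)] taken out; the integrand is positive at [0] thanks to [(2 - Y)^2]. *)
Lemma pairing_phi_gt0 : 0 < pairing phi1 phi2.
Proof.
have b : 0 < (2 - Y) * (2 - Y).
  by move: Yh => h; rewrite mulr_gt0// subr_gt0; lra.
have tb (x : R) := tanh_bound x.
have [M1 D1] := decaying_phi1; have [M2 D2] := decaying_phi2.
rewrite /pairing /past_slow /future_slow; apply: addr_gt0.
- have [N dN] : decaying (fun s => - slow1 g (- tanh s) * phi1 s + slow2 Y (- tanh s) * phi2 s).
    apply: decayingD; apply: decayingM.
    + by rewrite /slow1; multiplier_auto.
    + by exists M1.
    + by rewrite /slow2; multiplier_auto.
    + by exists M2.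
  have E s : - slow1 g (- tanh s) * phi1 s + slow2 Y (- tanh s) * phi2 s =
      sech s * (1 - tanh s) * (9 * (g * tanh s) ^+ 2 + (2 - Y) * (2 - Y)).
    by rewrite /slow1 /slow2 /phi1 /phi2; ring.
  apply: (past_gt0 (lexx 1) dN) => [s|]; rewrite E.
    have := tb s; rewrite ler_norml => /andP[_ t1].
    rewrite !mulr_ge0 ?subr_ge0 ?(ltW (sech_gt0 _))//.
    by rewrite addr_ge0 ?(ltW b)// mulr_ge0 ?sqr_ge0.
  have -> : tanh (0 : R) = 0 by rewrite /tanh oppr0 subrr mul0r.
  by rewrite subr0 mulr1 mulr0 expr0n mulr0 add0r mulr_gt0// sech_gt0.
- have [N dN] : decaying (fun s => slow1 g (tanh s) * phi1 s + slow2 Y (tanh s) * phi2 s).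
    apply: decayingD; apply: decayingM.
    + by rewrite /slow1; multiplier_auto.
    + by exists M1.
    + by rewrite /slow2; multiplier_auto.
    + by exists M2.
  have E s : slow1 g (tanh s) * phi1 s + slow2 Y (tanh s) * phi2 s =
      sech s * (1 + tanh s) * (9 * (g * tanh s) ^+ 2 + (2 - Y) * (2 - Y)).
    by rewrite /slow1 /slow2 /phi1 /phi2; ring.
  apply: (future_gt0 (lexx 1) dN) => [s|]; rewrite E.
    have := tb s; rewrite ler_norml => /andP[t1 _].
    have t2 : 0 <= 1 + tanh s by move: t1; rewrite -subr_ge0 opprK addrC.
    rewrite !mulr_ge0 ?(ltW (sech_gt0 _))//.
    by rewrite addr_ge0 ?(ltW b)// mulr_ge0 ?sqr_ge0.
  have -> : tanh (0 : R) = 0 by rewrite /tanh oppr0 subrr mul0r.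
  by rewrite addr0 mulr1 mulr0 expr0n mulr0 add0r mulr_gt0// sech_gt0.
Qed.

Lemma unstable_mode_of_parameters :
  exists sig m M (u1 du1 ddu1 u2 du2 ddu2 : R -> R),
  [/\ 0 < sig, 0 < m & u2 0 != 0] /\
  [/\ forall x, has_deriv u1 x (du1 x), forall x, has_deriv du1 x (ddu1 x),
      forall x, has_deriv u2 x (du2 x) & forall x, has_deriv du2 x (ddu2 x)] /\
  [/\ decay M u1, decay M du1 & decay M ddu1] /\
  [/\ decay M u2, decay M du2 & decay M ddu2] /\
  (forall x, g * (du2 x - 2 * tanh x * u2 x) + ddu1 x / 2 - m * u1 x
     + (1 - 3 * tanh x ^+ 2) * u1 x - sig * u2 x = 0) /\
  (forall x, - g * (du1 x + 2 * tanh x * u1 x) + ddu2 x / 2 - m * u2 x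
     + (1 - tanh x ^+ 2 - 2 * g ^+ 2) * u2 x + sig * u1 x = 0).
Proof.
have [A1 D1] := decaying_phi1; have [A2 D2] := decaying_phi2.
pose A := A1 + A2.
have A1p := decay_ge0 D1; have A2p := decay_ge0 D2.
have A0 : 0 <= A by rewrite addr_ge0.
have {}D1 : decay A phi1 by apply: decay_le D1; rewrite lerDl.
have {}D2 : decay A phi2 by apply: decay_le D2; rewrite lerDr.
have bL := bounded_form_pairing.
have [B B1 LB] := form_bound bL.
have B0 : 0 < B := lt_le_trans ltr01 B1.
have L0 := pairing_phi_gt0.
have h0 : 0 < 1 / 2 - Y by rewrite subr_gt0.
(* In this order: [eps < 2 - Y = |phi2 0|] keeps [u2 0] nonzero, [B * eps < L phi] keeps the growth
   rate positive, and the last bound, with [s <= eps] and [|u| <= A + eps], keeps the shifted [m]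
   positive. *)
have [eps [e0 eY eL eh]] : exists eps : R,
    [/\ 0 < eps, eps < 2 - Y, B * eps < pairing phi1 phi2 &
        eps * (B * (A + eps)) < 1 / 2 - Y].
  pose m := Num.min 1 (Num.min (pairing phi1 phi2) (1 / 2 - Y)).
  have m0 : 0 < m by rewrite !lt_min ltr01 L0.
  have m1 : m <= 1 by rewrite ge_min lexx.
  have mL : m <= pairing phi1 phi2 by rewrite !ge_min lexx orbT.
  have mY : m <= 1 / 2 - Y by rewrite !ge_min lexx !orbT.
  have Q : 1 <= A + 1 by rewrite lerDr.
  have BQ : 1 <= B * (A + 1) by rewrite mulr_ege1.
  have BQ0 : 0 < B * (A + 1) := lt_le_trans ltr01 BQ.
  exists (m / (2 * (B * (A + 1)))).
  have e1 : m / (2 * (B * (A + 1))) <= m / 2.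
    by rewrite invfM mulrA ler_piMr ?invf_le1// ltW// divr_gt0.
  have e2 : B * (m / (2 * (B * (A + 1)))) <= m / 2.
    rewrite [leLHS](_ : _ = m / 2 / (A + 1)).
      by rewrite ler_piMr ?invf_le1// ?(lt_le_trans ltr01 Q)// ltW// divr_gt0.
    by field; rewrite !gt_eqF// (lt_le_trans ltr01 Q).
  have e0 : 0 < m / (2 * (B * (A + 1))) by rewrite divr_gt0// mulr_gt0.
  have m2 : m / 2 < m by rewrite ltr_pdivrMr// ltr_pMr// ltr1n.
  split=> //.
  - apply: le_lt_trans e1 _; apply: lt_le_trans m2 _; apply: le_trans m1 _.
    by move: Yh => h; lra.
  - by apply: le_lt_trans e2 _; exact: lt_le_trans mL.
  - apply: lt_le_trans mY; apply: le_lt_trans m2.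
    rewrite [leRHS](_ : _ = m / (2 * (B * (A + 1))) * (B * (A + 1))); last first.
      by move: (B * (A + 1)) BQ0 => q q0; field; rewrite gt_eqF.
    rewrite ler_pM2l// ler_pM2l// lerD2l; apply: le_trans e1 _; lra.
have bK1 := bounded_op_resolvent1 g Y l1; have bK2 := bounded_op_resolvent2 g Y l1.
have [s [u1 [u2 [/andP[s0 se] eq1 eq2 du1 du2]]]] :=
  quadratic_fixed_point bK1 bK2 bL D1 D2 e0.
have U1 : decay (A + eps) u1.
  rewrite (_ : u1 = fun x => phi1 x + (u1 x - phi1 x)); first exact: decayD.
  by apply/funext => x; rewrite addrC subrK.
have U2 : decay (A + eps) u2.
  rewrite (_ : u2 = fun x => phi2 x + (u2 x - phi2 x)); first exact: decayD.
  by apply/funext => x; rewrite addrC subrK.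
pose F1 := nl1 pairing u1 u2; pose F2 := nl2 pairing u1 u2.
have [F1d F2d] := decay_nl LB U1 U2.
have LF : pairing F1 F2 = 0 := nl_annihilated bL U1 U2.
have lu : 0 < pairing u1 u2.
  have := bL.2 _ _ _ _ _ _ 1 1 D1 D2 du1 du2.
  rewrite !mul1r => E.
  have -> : pairing u1 u2 = pairing phi1 phi2 +
      pairing (fun x => u1 x - phi1 x) (fun x => u2 x - phi2 x).
    rewrite -E; congr pairing; apply/funext => x; ring.
  have := LB _ _ _ du1 du2; rewrite ler_norml => /andP[lo _].
  by move: eL lo => a b; lra.
have lj : `|s * pairing u2 (fun x => - u1 x)| < 1 / 2 - Y.
  rewrite normrM (gtr0_norm s0); apply: le_lt_trans eh.
  by apply: ler_pM; [exact: ltW| exact: normr_ge0 | exact: se | exact: LB U2 (decayN U1)].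
pose v1 x := dphi1 x + s * resolvent1_x g Y l F1 F2 x.
pose v2 x := dphi2 x + s * resolvent2_x g Y l F1 F2 x.
(* The second derivatives as the equation with source [s F] prescribes them: in this form their
   continuity and decay follow from those of [u], [v] and [F]. *)
pose z1 x := 2 * (s * F1 x - g * (v2 x - 2 * tanh x * u2 x)
  + (1 / 2 - Y - 1 + 3 * (tanh x * tanh x)) * u1 x).
pose z2 x := 2 * (s * F2 x + g * (v1 x + 2 * tanh x * u1 x)
  + (1 / 2 - Y - 1 + tanh x * tanh x + 2 * g * g) * u2 x).
have hu1 x : has_deriv u1 x (v1 x).
  rewrite (_ : u1 = fun x => phi1 x + s * resolvent1 g Y l F1 F2 x); last exact/funext.
  have d1 := has_deriv_phi1 x; have d2 := has_deriv_resolvent1 Y0 Yh gY l1 ll F1d F2d x.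
  by derive_eq; rewrite /v1; ring.
have hu2 x : has_deriv u2 x (v2 x).
  rewrite (_ : u2 = fun x => phi2 x + s * resolvent2 g Y l F1 F2 x); last exact/funext.
  have d1 := has_deriv_phi2 x; have d2 := has_deriv_resolvent2 Y0 Yh gY l1 ll F1d F2d x.
  by derive_eq; rewrite /v2; ring.
have hv1 x : has_deriv v1 x (z1 x).
  have d1 := has_deriv_dphi1 x; have d2 := has_deriv_resolvent1_x Y0 Yh gY l1 ll F1d F2d x.
  rewrite /v1; derive_eq; rewrite /z1 /v2 eq1 eq2 /residue1.
  by rewrite (pairing_kernel x F1d F2d).1 LF -/F1 -/F2; ring.
have hv2 x : has_deriv v2 x (z2 x).
  have d1 := has_deriv_dphi2 x; have d2 := has_deriv_resolvent2_x Y0 Yh gY l1 ll F1d F2d x.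
  rewrite /v2; derive_eq; rewrite /z2 /v1 eq1 eq2 /residue2.
  by rewrite (pairing_kernel x F1d F2d).2 LF -/F1 -/F2; ring.
have V1 : decaying v1.
  apply: decayingD decaying_dphi1 _; apply: (decayingM (multiplier_cst s)).
  by have [[C KC] _] := bounded_op_resolvent1_x g Y l1; eexists; exact: KC F1d F2d.
have V2 : decaying v2.
  apply: decayingD decaying_dphi2 _; apply: (decayingM (multiplier_cst s)).
  by have [[C KC] _] := bounded_op_resolvent2_x g Y l1; eexists; exact: KC F1d F2d.
have [eU1 eU2 eF1 eF2] : [/\ decaying u1, decaying u2, decaying F1 & decaying F2].
  by split; eexists; eassumption.
have Z1 : decaying z1.
  apply: (decayingM (multiplier_cst 2)); apply: decayingD; [apply: decayingD|].
  - exact: (decayingM (multiplier_cst s)).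
  - apply: decayingN; apply: (decayingM (multiplier_cst g)).
    apply: decayingD => //; apply: decayingN.
    by apply: (decayingM (h := fun x => 2 * tanh x)) => //; multiplier_auto.
  - by apply: (decayingM (h := fun x => 1 / 2 - Y - 1 + 3 * (tanh x * tanh x))) => //;
      multiplier_auto.
have Z2 : decaying z2.
  apply: (decayingM (multiplier_cst 2)); apply: decayingD; [apply: decayingD|].
  - exact: (decayingM (multiplier_cst s)).
  - apply: (decayingM (multiplier_cst g)).
    apply: decayingD => //.
    by apply: (decayingM (h := fun x => 2 * tanh x)) => //; multiplier_auto.
  - by apply: (decayingM (h := fun x => 1 / 2 - Y - 1 + tanh x * tanh x + 2 * g * g)) => //;
      multiplier_auto.
move: eU1 eU2 V1 V2 Z1 Z2 => [a1 E1] [a2 E2] [a3 E3] [a4 E4] [a5 E5] [a6 E6].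
have ge1 := decay_ge0 E1; have ge2 := decay_ge0 E2; have ge3 := decay_ge0 E3.
have ge4 := decay_ge0 E4; have ge5 := decay_ge0 E5; have ge6 := decay_ge0 E6.
exists (s * pairing u1 u2), (1 / 2 - Y - s * pairing u2 (fun x => - u1 x)).
exists (a1 + a2 + a3 + a4 + a5 + a6), u1, v1, z1, u2, v2, z2.
split; last split; last split; last split; last split.
- split; first exact: mulr_gt0.
    by move: lj; rewrite ltr_norml => /andP[_]; rewrite subr_gt0.
  (* If [u2 0 = 0], the closeness of [u2] to [phi2] at [0] forces [2 - Y <= eps]. *)
  apply: contraTneq eY => u0; rewrite -leNgt.
  have := du2.2 0; rewrite u0 sub0r normrN /phi2.
  have -> : sech (0 : R) = 1.
    by rewrite /sech oppr0 expR0 divff.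
  rewrite mulr1 normrN /ewt normr0 mul0r oppr0 expR0 mulr1.
  by apply: le_trans; exact: ler_norm.
- by split.
- by split; [apply: decay_le E1|apply: decay_le E3|apply: decay_le E5]; lra.
- by split; [apply: decay_le E2|apply: decay_le E4|apply: decay_le E6]; lra.
- by move=> x; rewrite /z1 /F1 /nl1; field.
- by move=> x; rewrite /z2 /F2 /nl2; field.
Qed.

End FixedParameters.
End Mode.

(** * Choice of the parameters and return to the original variables *)

Section Final.
Context {R : realType}.

Lemma unstable_mode (g : R) :
  exists sig m M (u1 du1 ddu1 u2 du2 ddu2 : R -> R),
  [/\ 0 < sig, 0 < m & u2 0 != 0] /\
  [/\ forall x, has_deriv u1 x (du1 x), forall x, has_deriv du1 x (ddu1 x),
      forall x, has_deriv u2 x (du2 x) & forall x, has_deriv du2 x (ddu2 x)] /\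
  [/\ decay M u1, decay M du1 & decay M ddu1] /\
  [/\ decay M u2, decay M du2 & decay M ddu2] /\
  (forall x, g * (du2 x - 2 * tanh x * u2 x) + ddu1 x / 2 - m * u1 x
     + (1 - 3 * tanh x ^+ 2) * u1 x - sig * u2 x = 0) /\
  (forall x, - g * (du1 x + 2 * tanh x * u1 x) + ddu2 x / 2 - m * u2 x
     + (1 - tanh x ^+ 2 - 2 * g ^+ 2) * u2 x + sig * u1 x = 0).
Proof.
pose G := g ^+ 2; have G0 : 0 <= G := sqr_ge0 g.
have GG : 0 <= G * G by rewrite mulr_ge0.
have r0 : 0 <= 1 + G + G * G by lra.
pose r := Num.sqrt (1 + G + G * G).
have rr : r * r = 1 + G + G * G by rewrite -expr2 sqr_sqrtr.
have rge0 : 0 <= r := sqrtr_ge0 _.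
have r1 : r <= 1 + G.
  rewrite -ler_sqr ?nnegrE//; first by rewrite !expr2 rr; lra.
  by rewrite addr_ge0.
(* Since [(G + 1/2)^2 = G^2 + G + 1/4]. This yields [Y < 1/2], hence a positive transverse frequency
   and nonzero Wronskians. *)
have r2 : G + 1 / 2 < r.
  rewrite -ltr_sqr ?nnegrE//; first by rewrite !expr2 rr; lra.
  by rewrite addr_ge0// divr_ge0.
(* The smaller root of [Y^2 - 2 (1 + G) Y + G = 0], whose reduced discriminant is
   [(1 + G)^2 - G = 1 + G + G^2]. *)
pose Y := 1 + G - r.
have Y0 : 0 <= Y by rewrite /Y; lra.
have Yh : Y < 1 / 2 by rewrite /Y; lra.
have gY : Y * Y = 2 * Y - g * g + 2 * g * g * Y.
  rewrite /Y; transitivity ((1 + G) ^+ 2 - 2 * (1 + G) * r + r * r); first ring.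
  by rewrite rr /G; ring.
have l0 : 0 <= 5 - 4 * Y by lra.
pose l := Num.sqrt (5 - 4 * Y).
have ll : l * l = 5 - 4 * Y by rewrite -expr2 sqr_sqrtr.
have l1 : 1 <= l by rewrite -(@sqrtr1 R) ler_wsqrtr//; lra.
exact: unstable_mode_of_parameters Y0 Yh gY l1 ll.
Qed.

Local Open Scope complex_scope.

Lemma linearized_GP_modeE (c sigma k z w1 w2 dw1 dw2 ddw1 ddw2 : R) :
  let a := Num.sqrt (1 - c ^+ 2) in let t := tanh (z * a) in
  linearized_GP_mode c sigma k z (w1 +i* w2) (dw1 +i* dw2) (ddw1 +i* ddw2) =
  (- sigma * w2 + c * dw2 + (ddw1 - k ^+ 2 * w1) / 2
     + (1 - (a ^+ 2 * t ^+ 2 + c ^+ 2)) * w1 - 2 * (a * t * w1 + c * w2) * (a * t))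
  +i* (sigma * w1 - c * dw1 + (ddw2 - k ^+ 2 * w2) / 2
     + (1 - (a ^+ 2 * t ^+ 2 + c ^+ 2)) * w2 - 2 * (a * t * w1 + c * w2) * c).
Proof.
move=> a t; rewrite /linearized_GP_mode /Psi -/a -/t normCK.
have -> : (2 : R[i]) = 2%:C by rewrite rmorph_nat.
rewrite -fmorphV.
by simpc => /=; congr (_ +i* _); field.
Qed.

End Final.

Theorem theorem3p3 (R : realType) (c : R) (hc : `|c| < 1) :
  transversally_linearly_unstable c.
Proof.
have c2 : c ^+ 2 < 1.
  by rewrite -real_normK ?num_real// expr_lt1.
pose a := Num.sqrt (1 - c ^+ 2).
have a0 : 0 < a by rewrite sqrtr_gt0 subr_gt0.
have aa : a ^+ 2 = 1 - c ^+ 2 by rewrite sqr_sqrtr// subr_ge0 ltW.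
have an : a != 0 by rewrite gt_eqF.
pose g := c / a.
have cag : c = a * g by rewrite /g mulrC divfK.
have [sig [m [M [u1 [du1 [ddu1 [u2 [du2 [ddu2 [[s0 m0 u20]
  [[h1 h2 h3 h4] [[d1 d2 d3] [[e1 e2 e3] [E1 E2]]]]]]]]]]]]]] := unstable_mode g.
have k0 : 0 < 2 * a ^+ 2 * m by rewrite !mulr_gt0// exprn_gt0.
(* In the rescaled variable the transverse term is [k^2 / (2 a^2)], which has to be [m]. *)
pose k := Num.sqrt (2 * a ^+ 2 * m).
have kk : k ^+ 2 = 2 * a ^+ 2 * m by rewrite sqr_sqrtr// ltW.
have scale f df : (forall x, has_deriv f x (df x)) ->
    forall z, has_deriv (fun z => f (z * a)) z (a * df (z * a)).
  move=> fd z; apply: has_deriv_eq.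
    apply: (has_deriv_comp (g := fun z => z * a)); last exact: fd.
    by derive_auto.
  by cbv beta; ring.
have scaleM (b : R) f df : (forall x, has_deriv f x (df x)) ->
    forall z, has_deriv (fun z => b * f z) z (b * df z).
  by move=> fd z; have d := fd z; derive_eq; ring.
(* The factors [1], [a] and [a ^+ 2] produced by rescaling are at most [1], so one constant [M]
   bounds the mode and both derivatives. *)
have bound b f : b <= 1 -> 0 <= b -> decay M f ->
    forall z, `|b * f (z * a)| <= M * expR (- (a / 2 * `|z|)).
  move=> b1 b0 df z; rewrite normrM (ger0_norm b0).
  apply: (@le_trans _ _ `|f (z * a)|); first by rewrite ler_piMl.
  apply: le_trans (df.2 _) _; rewrite /ewt normrM (gtr0_norm a0).
  rewrite [`|z| * a / 2](_ : _ = a / 2 * `|z|)//; ring.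
have a1 : a ^+ 2 <= 1 by rewrite aa gerBl sqr_ge0.
have a1' : a <= 1 by rewrite -(expr_le1 (n := 2))// ltW.
have H2w u du ddu : (forall x, has_deriv u x (du x)) ->
    (forall x, has_deriv du x (ddu x)) -> decay M u -> decay M du -> decay M ddu ->
    H2 (fun z => u (z * a)) (fun z => a * du (z * a)) (fun z => a ^+ 2 * ddu (z * a)).
  move=> hu hdu du0 du1' du2'; apply: (@H2_exp _ _ _ _ (a / 2) M).
  - by rewrite divr_gt0.
  - exact: scale.
  - move=> z; apply: has_deriv_eq; first exact: (scaleM a _ _ (scale _ _ hdu)).
    by rewrite expr2 mulrA.
  - have ca : continuous (fun z : R => ddu (z * a)).
      move=> z; apply: continuous_comp; last exact: du2'.1.
      by apply: (@has_deriv_continuous _ (fun z => z * a)); derive_auto.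
    by move=> z; apply: cvgM; [exact: cvg_cst | exact: ca].
  - by move=> z; have := bound 1 _ (lexx 1) ler01 du0 z; rewrite mul1r.
  - by apply: bound => //; exact: ltW.
  - by apply: bound => //; exact: sqr_ge0.
exists (a ^+ 2 * sig), k, (fun z => u1 (z * a)), (fun z => a * du1 (z * a)),
  (fun z => a ^+ 2 * ddu1 (z * a)), (fun z => u2 (z * a)),
  (fun z => a * du2 (z * a)), (fun z => a ^+ 2 * ddu2 (z * a)).
split; last split.
- split; [by rewrite mulr_gt0// exprn_gt0 | | exact: H2w | exact: H2w].
  by rewrite gt_eqF// sqrtr_gt0.
(* Nontriviality is read off the imaginary part, whose value at [0] is [u2 0]. *)
- move=> w0; apply: (@not_ae_eq0 _ (fun z => u2 (z * a))).
  + move=> z; exact: has_deriv_continuous (scale _ _ h3 z).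
  + by rewrite mul0r.
  + apply: filterS w0; first exact: (ae_filter_ringOfSetsType lebesgue_measure).
    by move=> z /(congr1 (@complex.Im R)).
- apply: aeW => z; rewrite linearized_GP_modeE -/a kk.
  (* With [1 - c^2 = a^2] and [c = a g], each component of the equation at [z] is [a ^+ 2] times the
     rescaled one at [z * a]. *)
  have c1 : 1 - (a ^+ 2 * tanh (z * a) ^+ 2 + c ^+ 2) =
      a ^+ 2 * (1 - tanh (z * a) ^+ 2) by rewrite mulrBr aa; ring.
  rewrite c1 cag.
  rewrite [X in Complex X _](_ : _ = 0); last first.
    by rewrite -[RHS](mulr0 (a ^+ 2)) -(E1 (z * a)); field.
  rewrite [X in Complex _ X](_ : _ = 0) //.
  by rewrite -[RHS](mulr0 (a ^+ 2)) -(E2 (z * a)); field.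
Qed.
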